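(* Let $d\ge 1$, $S\in\tfrac12\mathbb{N}=\{\tfrac12,1,\tfrac32,\dots\}$, $u\in[0,1]$ and $\beta>0$. Let $L$ be an even integer, $\Lambda=\{-\tfrac12L,\dots,\tfrac12L\}^d\subset\mathbb{Z}^d$, and $\mathcal{E}_\Lambda$ the set of (unordered) nearest-neighbour pairs $xy$ with $x,y\in\Lambda$. Let $\mathbf{h}=(h_x)_{x\in\Lambda}$ with $h_x\in[0,\infty)$ and consider on $\mathcal{H}_\Lambda=\bigotimes_{x\in\Lambda}\mathbb{C}^{2S+1}$ the Hamiltonian \[ H_{\Lambda,\mathbf{h}}=-\sum_{xy\in\mathcal{E}_\Lambda}\bigl(uT_{xy}+(1-u)Q_{xy}-1\bigr)-\sum_{x\in\Lambda}h_xS^3_x , \] with states $\langle M\rangle_{\Lambda,\mathbf{h}}=\operatorname{Tr}(Me^{-\beta H_{\Lambda,\mathbf{h}}})/\operatorname{Tr}e^{-\beta H_{\Lambda,\mathbf{h}}}$. Assume that $h_x\ge\alpha$ for all $x\in\Lambda$, for some $\alpha>0$. Then there exist constants $C,c>0$, depending on $S,d,\alpha$ but not on $L$ or $\beta$, such that \[ 0<\langle S^1_0S^1_x\rangle_{\Lambda,\mathbf{h}}<Ce^{-c\|x\|}\qquad\text{for all }x\in\Lambda . \]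
   Context: Let $|a\rangle$, $a=-S,-S+1,\dots,S$, be the basis of $\mathbb{C}^{2S+1}$ of eigenvectors of the spin operator $S^3$, $S^3|a\rangle=a|a\rangle$; $S^1,S^2,S^3$ are the standard spin-$S$ operators (satisfying $[S^1,S^2]=iS^3$ and cyclic permutations), and $S^i_x$ denotes $S^i$ acting on the factor at site $x$. The transposition operator $T_{xy}$ acts on $\mathbb{C}^{2S+1}\otimes\mathbb{C}^{2S+1}$ (sites $x,y$) by $T_{xy}|a\rangle_x\otimes|b\rangle_y=|b\rangle_x\otimes|a\rangle_y$, and $Q_{xy}$ has matrix elements $\langle a|_x\otimes\langle b|_y\,Q_{xy}\,|c\rangle_x\otimes|d\rangle_y=\delta_{a,b}\delta_{c,d}$. For $S=\tfrac12$ this Hamiltonian equals $-2\sum_{xy}(S^1_xS^1_y+(2u-1)S^2_xS^2_y+S^3_xS^3_y-\tfrac14)-\sum_x h_xS^3_x$ (e.g. $u=1$ Heisenberg ferromagnet, $u=\tfrac12$ XY model). $\|x\|$ denotes the (Euclidean) norm of $x\in\mathbb{Z}^d$. *)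

(* Defs.v *)
From HB Require Import structures.
From mathcomp Require Import all_boot all_order all_algebra.
From mathcomp Require Import all_classical all_reals all_analysis.
Set Implicit Arguments.
Unset Strict Implicit.
Unset Printing Implicit Defensive.
Import Order.TTheory GRing.Theory Num.Theory.
Import numFieldNormedType.Exports.
Local Open Scope ring_scope.

Section Spin.
Variables (R : realType) (d l m : nat).
(* L = 2 * l ; 2S = m ; local dimension 2S+1 = m.+1 *)

(* sites of Lambda = {-L/2,...,L/2}^d : coordinate i of x is (x i) - l *)
Definition site := {ffun 'I_d -> 'I_(2 * l).+1}.
Definition coord (x : site) (i : 'I_d) : int := (x i)%:Z - l%:Z.
Definition origin : site := [ffun _ => inord l].
Definition nn (x y : site) : bool :=
  (\sum_(i < d) absz (coord x i - coord y i) == 1)%N.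
Definition eucl_norm (x : site) : R :=
  Num.sqrt (\sum_(i < d) ((coord x i)%:~R : R) ^+ 2).

(* basis configurations of H_Lambda: sigma x = k means |k - S>_x *)
Definition cfg := {ffun site -> 'I_m.+1}.
Definition Mx := 'M[R]_#|cfg|.
Definition mx_of (f : cfg -> cfg -> R) : Mx :=
  \matrix_(i, j) f (enum_val i) (enum_val j).

Definition spinS : R := m%:R / 2.
Definition spin_val (k : 'I_m.+1) : R := k%:R - spinS.

Definition S3_loc (a b : 'I_m.+1) : R := (a == b)%:R * spin_val a.
Definition S1_loc (a b : 'I_m.+1) : R :=
  if ((a : nat) == b.+1) || ((b : nat) == a.+1)
  then Num.sqrt (spinS * (spinS + 1) - spin_val a * spin_val b) / 2
  else 0.

Definition agree_off (sigma tau : cfg) (P : pred site) : bool :=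
  [forall z, P z || (sigma z == tau z)].

Definition at_site (A : 'I_m.+1 -> 'I_m.+1 -> R) (x : site) : Mx :=
  mx_of (fun sigma tau => A (sigma x) (tau x) * (agree_off sigma tau (pred1 x))%:R).
Definition S1_op (x : site) : Mx := at_site S1_loc x.
Definition S3_op (x : site) : Mx := at_site S3_loc x.

Definition T_op (x y : site) : Mx :=
  mx_of (fun sigma tau =>
    [&& sigma x == tau y, sigma y == tau x &
        agree_off sigma tau [pred z | (z == x) || (z == y)]]%:R).
Definition Q_op (x y : site) : Mx :=
  mx_of (fun sigma tau =>
    [&& sigma x == sigma y, tau x == tau y &
        agree_off sigma tau [pred z | (z == x) || (z == y)]]%:R).

(* H = - sum_{xy in E} (u T + (1-u) Q - 1) - sum_x h_x S^3_x ;
   each unordered edge counted once via enum_rank x < enum_rank y *)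
Definition hamiltonian (u : R) (h : site -> R) : Mx :=
  - (\sum_(x : site) \sum_(y : site | nn x y && (enum_rank x < enum_rank y)%N)
        (u *: T_op x y + (1 - u) *: Q_op x y - 1%:M))
  - \sum_(x : site) h x *: S3_op x.

Definition expmx (A : Mx) : Mx :=
  \matrix_(i, j) limn (fun N : nat => ((\sum_(k < N) (k`!%:R)^-1 *: (A ^+ k)) i j : R)).

Definition gibbs (beta u : R) (h : site -> R) (M : Mx) : R :=
  \tr (M *m expmx (- beta *: hamiltonian u h)) /
  \tr (expmx (- beta *: hamiltonian u h)).

End Spin.

(* Main.v *)
(** Write [-H = K - |E| + F] with [K] the couplings and [F] the field, and
    approximate [e^(-beta H)] by [(e^(dF) (1 + d (K - |E|)))^M], [d = beta / M].
    Expanding the product gives a sum over sets of links in space-time and over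
    spin configurations that are constant along every link.

    Domination: raising the spin on the component with the smaller value does
    not decrease the weight, so imposing one more equality of spins costs at
    most a factor [2(2S+1)].  Removing a [T] or [Q] link is possible after
    imposing one equality; hence links are dominated by a Bernoulli field of
    density of order [d].

    Decay: [S^1_0 S^1_x] cuts the configuration at [0] and [x] at time [0].  By
    conservation of parity the two components of the cut at [0] both reach [x],
    and raising the lower one, [C] say, gains [e^(-alpha |C|)], [|C|] its duration.
    Either [|C| >= eps |x|_1], or [0] and [x] are joined by a chain of [|x|_1]
    distinct links of short total duration, which a union bound excludes up to
    an exponentially small probability.  All constants are uniform in [M].

    Positivity: [-H] plus a constant has nonnegative entries and moves one
    excitation from [0] to [x] with [T] links, or two sites at a time with [Q]
    links; when [u = 0] and [|x|_1] is odd, it annihilates a pair of excitations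
    at [0] and [x]. *)

Require Import Defs.
From HB Require Import structures.
From mathcomp Require Import all_boot all_order all_algebra.
From mathcomp Require Import perm.
From mathcomp Require Import all_classical all_reals all_analysis.
From mathcomp Require Import zify ring lra.
Set Implicit Arguments.
Unset Strict Implicit.
Unset Printing Implicit Defensive.
Import Order.TTheory GRing.Theory Num.Theory.
Import numFieldNormedType.Exports.
Local Open Scope ring_scope.

(** * The matrix exponential *)

Section OperatorNorm.
Variables (R : realDomainType) (n : nat).
Implicit Types (A B : 'M[R]_n).

(* The operator norm for the supremum norm on column vectors. *)
Definition opnorm A : R := \big[Num.max/0]_i \sum_j `|A i j|.

Lemma opnorm_ge0 A : 0 <= opnorm A.
Proof. by rewrite /opnorm; elim/big_rec: _ => // i x _ x0; rewrite le_max x0 orbT. Qed.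

Lemma row_sum_le_opnorm A i : \sum_j `|A i j| <= opnorm A.
Proof. exact: (le_bigmax _ (fun i => \sum_j `|A i j|)). Qed.

Lemma opnorm_le A c : 0 <= c -> (forall i, \sum_j `|A i j| <= c) -> opnorm A <= c.
Proof. by move=> c0 Ac; apply: bigmax_le. Qed.

Lemma entry_le_opnorm A i j : `|A i j| <= opnorm A.
Proof.
by apply: le_trans (row_sum_le_opnorm A i); rewrite (bigD1 j) //= lerDl sumr_ge0.
Qed.

Lemma opnorm_le_sum A : opnorm A <= \sum_i \sum_j `|A i j|.
Proof.
have rows_ge0 i : 0 <= \sum_j `|A i j| by apply: sumr_ge0.
by apply: opnorm_le => [|i]; [|rewrite [leRHS](bigD1 i) //= lerDl]; apply: sumr_ge0.
Qed.

Lemma ler_opnormD A B : opnorm (A + B) <= opnorm A + opnorm B.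
Proof.
apply: opnorm_le => [|i]; first by rewrite addr_ge0 ?opnorm_ge0.
apply: le_trans (lerD (row_sum_le_opnorm A i) (row_sum_le_opnorm B i)).
by rewrite -big_split; apply: ler_sum => j _; rewrite mxE ler_normD.
Qed.

Lemma ler_opnormZ x A : opnorm (x *: A) <= `|x| * opnorm A.
Proof.
apply: opnorm_le => [|i]; first by rewrite mulr_ge0 ?opnorm_ge0.
apply: le_trans (ler_wpM2l (normr_ge0 x) (row_sum_le_opnorm A i)).
by rewrite mulr_sumr; apply: ler_sum => j _; rewrite mxE normrM.
Qed.

Lemma ler_opnormM A B : opnorm (A * B) <= opnorm A * opnorm B.
Proof.
apply: opnorm_le => [|i]; first by rewrite mulr_ge0 ?opnorm_ge0.
apply: le_trans (ler_wpM2r (opnorm_ge0 B) (row_sum_le_opnorm A i)).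
apply: (@le_trans _ _ (\sum_j \sum_k `|A i k| * `|B k j|)).
  apply: ler_sum => j _; rewrite mxE; apply: le_trans (ler_norm_sum _ _ _) _.
  by apply: ler_sum => k _; rewrite normrM.
rewrite exchange_big mulr_suml; apply: ler_sum => k _.
by rewrite -mulr_sumr ler_wpM2l ?row_sum_le_opnorm.
Qed.

Lemma opnorm1_le1 : opnorm 1 <= 1.
Proof.
apply: opnorm_le => // i; rewrite (bigD1 i) //= mxE eqxx normr1 big1 ?addr0 // => j ji.
by rewrite mxE eq_sym (negbTE ji) normr0.
Qed.

Lemma ler_opnormX A k : opnorm (A ^+ k) <= opnorm A ^+ k.
Proof.
elim: k => [|k IHk]; first by rewrite !expr0 opnorm1_le1.
by rewrite !exprS (le_trans (ler_opnormM _ _)) // ler_wpM2l ?opnorm_ge0.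
Qed.

Lemma ler_opnorm_sum (I : Type) (r : seq I) (F : I -> 'M[R]_n) :
  opnorm (\sum_(i <- r) F i) <= \sum_(i <- r) opnorm (F i).
Proof.
elim: r => [|i r IHr]; last by rewrite !big_cons (le_trans (ler_opnormD _ _)) // lerD2l.
by rewrite !big_nil; apply: opnorm_le => // i; rewrite big1 // => j _; rewrite mxE normr0.
Qed.

Lemma ler_opnorm_subX A B c k : opnorm A <= c -> opnorm B <= c ->
  opnorm (A ^+ k.+1 - B ^+ k.+1) <= k.+1%:R * c ^+ k * opnorm (A - B).
Proof.
move=> Ac Bc; have c0 := le_trans (opnorm_ge0 A) Ac.
elim: k => [|k IHk]; first by rewrite !expr1 expr0 !mul1r.
have -> : A ^+ k.+2 - B ^+ k.+2 = A ^+ k.+1 * (A - B) + (A ^+ k.+1 - B ^+ k.+1) * B.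
  by rewrite mulrBr mulrBl -!exprSr addrA subrK.
apply: le_trans (ler_opnormD _ _) _.
have -> : k.+2%:R * c ^+ k.+1 * opnorm (A - B) =
    c ^+ k.+1 * opnorm (A - B) + k.+1%:R * c ^+ k * opnorm (A - B) * c.
  by rewrite -(natr1 k.+1) exprS; ring.
apply: lerD; apply: le_trans (ler_opnormM _ _) _; last by rewrite ler_pM ?opnorm_ge0.
rewrite ler_wpM2r ?opnorm_ge0 // (le_trans (ler_opnormX _ _)) // lerXn2r ?nnegrE ?opnorm_ge0 //.
Qed.

End OperatorNorm.

Section CompoundLimits.
Variable R : realType.
Implicit Types x : R.

Lemma expR_sub1_le x : expR x - 1 <= x * expR x.
Proof.
have := expR_ge1Dx (- x); rewrite expRN => /(ler_wpM2r (expR_ge0 x)).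
by rewrite mulVf ?expR_eq0 // mulrDl mul1r mulNr lerBlDr lerBlDl addrC.
Qed.

Lemma cvg_divS x : (x / N.+1%:R @[N --> \oo] --> 0)%classic.
Proof. by rewrite -(mulr0 x); apply: cvgM; [apply: cvg_cst|apply: cvg_harmonic]. Qed.

Lemma near_mul_divS_le x y eps : 0 < eps ->
  \forall N \near (\oo)%classic, x * (y / N.+1%:R) <= eps.
Proof.
move=> eps0; have cvg0 : (x * (y / N.+1%:R) @[N --> \oo] --> (0 : R))%classic.
  by rewrite -(mulr0 x); apply: cvgMr; apply: cvg_divS.
exact: cvgr_le cvg0 _ eps0.
Qed.

Lemma cvg_expR_divS x : (expR (x / N.+1%:R) @[N --> \oo] --> (1 : R))%classic.
Proof.
rewrite -[X in (_ --> X)%classic]expR0.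
exact: (cvg_comp _ _ (cvg_divS x) (@continuous_expR R 0)).
Qed.

Lemma cvg_mul_expR_divS_sub1 x :
  (N.+1%:R * (expR (x / N.+1%:R) - 1) @[N --> \oo] --> x)%classic.
Proof.
apply: (@squeeze_cvgr _ _ _ _ (cst x) (fun N => x * expR (x / N.+1%:R))).
- apply: nearW => N; have N0 : 0 < N.+1%:R :> R by [].
  rewrite -ler_pdivrMl // mulrC lerBrDl expR_ge1Dx /= -ler_pdivlMl // mulrA (mulrC _^-1).
  exact: expR_sub1_le.
- exact: cvg_cst.
- by rewrite -[X in (_ --> X)%classic]mulr1; apply: cvgM; [apply: cvg_cst|apply: cvg_expR_divS].
Qed.

Lemma expR_div1D_le x : 0 < 1 + x -> expR (x / (1 + x)) <= 1 + x.
Proof.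
move=> x1; rewrite -[leRHS]invrK -[leLHS]invrK -expRN lef_pV2 ?posrE ?invr_gt0 ?expR_gt0 //.
have inv1D : (1 + x)^-1 = 1 - x / (1 + x) by field; rewrite gt_eqF.
by rewrite [leLHS]inv1D expR_ge1Dx.
Qed.

Lemma cvg_compound x : ((1 + x / N.+1%:R) ^+ N.+1 @[N --> \oo] --> expR x)%classic.
Proof.
have cvg1 : (1 + x / N.+1%:R @[N --> \oo] --> (1 : R))%classic.
  by rewrite -[X in (_ --> X)%classic]addr0; apply: cvgD; [apply: cvg_cst|apply: cvg_divS].
apply: (@squeeze_cvgr _ _ _ _ (fun N => expR (x / (1 + x / N.+1%:R))) (cst (expR x))).
- near=> N; have t0 : 0 < 1 + x / N.+1%:R by near: N; apply: (cvgr_gt 1 cvg1).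
  have scale y : expR (x / N.+1%:R / y) ^+ N.+1 = expR (x / y).
    by rewrite -expRM_natl mulrA mulrCA mulfV ?mulr1.
  rewrite -scale -[X in _ <= _ <= expR X]divr1 -scale divr1.
  by rewrite !lerXn2r ?nnegrE ?expR_ge0 ?expR_ge1Dx ?(ltW t0) ?expR_div1D_le.
- have cvg_arg : (x / (1 + x / N.+1%:R) @[N --> \oo] --> x)%classic.
    by rewrite -[X in (_ --> X)%classic]divr1; apply: cvgM; [apply: cvg_cst|apply: cvgV].
  exact: (cvg_comp _ _ cvg_arg (@continuous_expR R x)).
- exact: cvg_cst.
Unshelve. all: by end_near.
Qed.

End CompoundLimits.
Section MatrixExponential.
Variables (R : realType) (n : nat).
Implicit Types (A B K : 'M[R]_n) (i j : 'I_n).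

Definition exp_partial A N : 'M[R]_n := \sum_(k < N) (k`!%:R)^-1 *: (A ^+ k).

Definition mxexp A : 'M[R]_n :=
  \matrix_(i, j) limn (fun N : nat => exp_partial A N i j : R).

Lemma cvg_exp_partial A i j : (exp_partial A N i j @[N --> \oo] --> mxexp A i j)%classic.
Proof.
have seriesE : (fun N => exp_partial A N i j) = series (fun k => (k`!%:R)^-1 * (A ^+ k) i j).
  apply/funext => N; rewrite /series /= big_mkord summxE.
  by apply: eq_bigr => k _; rewrite mxE.
suff : cvgn (fun N => exp_partial A N i j) by rewrite mxE.
rewrite seriesE; apply: (@normed_cvg R R^o).
apply: series_le_cvg (is_cvg_series_exp_coeff (opnorm A)) => k.
- exact: normr_ge0.
- by apply: exp_coeff_ge0; apply: opnorm_ge0.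
- rewrite /exp_coeff /= normrM mulrC [`|_^-1|]ger0_norm ?invr_ge0 ?ler0n //.
  rewrite ler_wpM2r ?invr_ge0 ?ler0n //.
  exact: le_trans (entry_le_opnorm _ _ _) (ler_opnormX _ _).
Qed.

Lemma exprmxZ x A k : (x *: A) ^+ k = x ^+ k *: A ^+ k.
Proof.
elim: k => [|k IHk]; first by rewrite !expr0 scale1r.
rewrite !exprS IHk -[LHS]/((x *: A) *m (x ^+ k *: A ^+ k)).
by rewrite -scalemxAl -scalemxAr scalerA.
Qed.

(* Coefficientwise [(1 + A / N) ^ N] is dominated by the exponential series, so
   the error for a matrix is at most the error for its norm. *)
Lemma ler_opnorm_exp_partial_sub A N :
  opnorm (exp_partial A N.+2 - (1 + N.+1%:R^-1 *: A) ^+ N.+1) <=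
  series (exp_coeff (opnorm A)) N.+2 - (1 + opnorm A / N.+1%:R) ^+ N.+1.
Proof.
set y := N.+1%:R^-1; pose a (k : nat) : R := (k`!%:R)^-1 - y ^+ k *+ 'C(N.+1, k).
have a_ge0 k : 0 <= a k.
  rewrite subr_ge0 -mulr_natr /y exprVn mulrC ler_pdivrMr; last by rewrite exprn_gt0 ?ltr0n.
  rewrite ler_pdivlMl ?ltr0n ?fact_gt0 // -natrM -natrX ler_nat mulnC bin_ffact.
  rewrite ffact_prod -[k in leqRHS]card_ord -prod_nat_const.
  by apply: leq_prod => i _; apply: leq_subr.
have -> : exp_partial A N.+2 - (1 + y *: A) ^+ N.+1 = \sum_(k < N.+2) a k *: A ^+ k.
  rewrite [1 + _]addrC exprD1n /exp_partial -sumrB; apply: eq_bigr => k _.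
  by rewrite exprmxZ /a scalerBl scalerMnl.
have -> : series (exp_coeff (opnorm A)) N.+2 - (1 + opnorm A * y) ^+ N.+1 =
    \sum_(k < N.+2) a k * opnorm A ^+ k.
  rewrite [1 + _]addrC exprD1n /series /= big_mkord -sumrB; apply: eq_bigr => k _.
  by rewrite exprMn /exp_coeff /a mulrBl mulrnAl [_^-1 * _]mulrC [y ^+ _ * _]mulrC.
apply: le_trans (ler_opnorm_sum _ _) _; apply: ler_sum => k _.
by rewrite (le_trans (ler_opnormZ _ _)) // ger0_norm // ler_wpM2l ?ler_opnormX.
Qed.

Lemma cvg_mxexp_pow A i j :
  (((1 + N.+1%:R^-1 *: A) ^+ N.+1) i j @[N --> \oo] --> mxexp A i j)%classic.
Proof.
have cvg_partial : (exp_partial A N.+2 i j @[N --> \oo] --> mxexp A i j)%classic.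
  by have := @cvg_exp_partial A i j; rewrite -cvg_shiftS -cvg_shiftS.
have cvg_gap : (series (exp_coeff (opnorm A)) N.+2 - (1 + opnorm A / N.+1%:R) ^+ N.+1
    @[N --> \oo] --> (0 : R))%classic.
  rewrite -(subrr (expR (opnorm A))); apply: cvgB; last exact: cvg_compound.
  by have := is_cvg_series_exp_coeff (opnorm A); rewrite -cvg_shiftS -cvg_shiftS.
apply: (cvg_sub0 _ cvg_partial); apply: norm_cvg0.
apply: (squeeze_cvgr _ (cvg_cst 0) cvg_gap); apply: nearW => N.
rewrite normr_ge0 /= distrC (le_trans _ (ler_opnorm_exp_partial_sub A N)) //.
by apply: le_trans (entry_le_opnorm _ i j); rewrite !mxE.
Qed.

Lemma ler_opnorm_compound_sub A B c N : opnorm A <= c -> opnorm B <= c ->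
  opnorm ((1 + N.+1%:R^-1 *: A) ^+ N.+1 - (1 + N.+1%:R^-1 *: B) ^+ N.+1) <=
  opnorm (A - B) * expR c.
Proof.
move=> Ac Bc; have c0 := le_trans (opnorm_ge0 A) Ac.
set t : R := N.+1%:R^-1; have t0 : 0 <= t by rewrite invr_ge0.
have tc0 : 0 <= 1 + t * c by rewrite addr_ge0 ?mulr_ge0.
have opnorm1D (C : 'M[R]_n) : opnorm C <= c -> opnorm (1 + t *: C) <= 1 + t * c.
  move=> Cc; apply: le_trans (ler_opnormD _ _) (lerD (opnorm1_le1 _ _) _).
  by rewrite (le_trans (ler_opnormZ _ _)) // ger0_norm // ler_wpM2l.
have compound_le : (1 + t * c) ^+ N <= expR c.
  apply: (@le_trans _ _ (expR (t * c) ^+ N)).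
    by rewrite lerXn2r ?nnegrE ?expR_ge0 ?expR_ge1Dx.
  rewrite -expRM_natl ler_expR (@le_trans _ _ (N.+1%:R * (t * c))) //.
    by rewrite ler_wpM2r ?mulr_ge0 ?ler_nat.
  by rewrite mulrA mulfV ?mul1r.
apply: le_trans (ler_opnorm_subX N (opnorm1D _ Ac) (opnorm1D _ Bc)) _.
have -> : 1 + t *: A - (1 + t *: B) = t *: (A - B).
  by rewrite scalerBr opprD addrACA subrr add0r.
have -> : opnorm (A - B) * expR c = N.+1%:R * expR c * (t * opnorm (A - B)).
  by rewrite mulrACA mulfV // mul1r mulrC.
rewrite ler_pM ?opnorm_ge0 ?ler_wpM2l ?mulr_ge0 ?exprn_ge0 //.
by rewrite (le_trans (ler_opnormZ _ _)) // ger0_norm.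
Qed.

Lemma cvg_opnorm_sub (A_ : nat -> 'M[R]_n) A :
  (forall i j, (A_ N i j @[N --> \oo] --> A i j)%classic) ->
  (opnorm (A_ N - A) @[N --> \oo] --> (0 : R))%classic.
Proof.
move=> cvgA.
have cvg_sum : (\sum_i \sum_j `|A_ N i j - A i j| @[N --> \oo] --> (0 : R))%classic.
  rewrite [X in (_ --> X)%classic](_ : 0 = \sum_(i < n) \sum_(j < n) 0); last first.
    by rewrite !big1 // => i _; rewrite big1.
  apply: cvg_big => [|i _]; first exact: add_continuous.
  apply: cvg_big => [|j _]; first exact: add_continuous.
  have : (`|A_ N i j - A i j| @[N --> \oo] --> `|A i j - A i j|)%classic.
    by apply: cvg_norm; apply: cvgB => //; apply: cvg_cst.
  by rewrite subrr normr0.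
apply: (squeeze_cvgr _ (cvg_cst 0) cvg_sum); apply: nearW => N.
rewrite opnorm_ge0 (le_trans (opnorm_le_sum _)) //.
by do 2!apply: ler_sum => ? _; rewrite !mxE.
Qed.

Lemma cvg_mxexp (A_ : nat -> 'M[R]_n) A i j :
  (forall i j, (A_ N i j @[N --> \oo] --> A i j)%classic) ->
  (((1 + N.+1%:R^-1 *: A_ N) ^+ N.+1) i j @[N --> \oo] --> mxexp A i j)%classic.
Proof.
move=> cvgA; have cvg_e := cvg_opnorm_sub cvgA; set e := fun N => _ in cvg_e.
have cvg_c : (opnorm A + e N @[N --> \oo] --> opnorm A + 0)%classic.
  by apply: cvgD => //; apply: cvg_cst.
have cvg_bound : (e N * expR (opnorm A + e N) @[N --> \oo] --> (0 : R))%classic.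
  rewrite -(mul0r (expR (opnorm A + 0))); apply: cvgM => //.
  exact: (cvg_comp _ _ cvg_c (@continuous_expR R _)).
apply: (cvg_sub0 _ (@cvg_mxexp_pow A i j)); apply: norm_cvg0.
apply: (squeeze_cvgr _ (cvg_cst 0) cvg_bound); apply: nearW => N; rewrite normr_ge0 /=.
apply: le_trans (ler_opnorm_compound_sub N _ _); last by rewrite lerDl opnorm_ge0.
  by apply: le_trans (entry_le_opnorm _ i j); rewrite !mxE.
by rewrite -{1}(subrK A (A_ N)) addrC ler_opnormD.
Qed.

Lemma cvg_trotter_diag K (f : 'rV[R]_n) i j :
  (((diag_mx (map_mx expR (N.+1%:R^-1 *: f)) *m (1 + N.+1%:R^-1 *: K)) ^+ N.+1) i j
    @[N --> \oo] --> mxexp (K + diag_mx f) i j)%classic.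
Proof.
pose P N : 'M[R]_n := diag_mx (map_mx expR (N.+1%:R^-1 *: f)) *m (1 + N.+1%:R^-1 *: K).
pose A_ N : 'M[R]_n := N.+1%:R *: (P N - 1).
have P_E N : P N = 1 + N.+1%:R^-1 *: A_ N.
  by rewrite /A_ scalerA mulVf // scale1r [RHS]addrC subrK.
suff : (((1 + N.+1%:R^-1 *: A_ N) ^+ N.+1) i j @[N --> \oo] --> mxexp (K + diag_mx f) i j)%classic.
  by under eq_fun do rewrite -P_E.
apply: cvg_mxexp => k l; rewrite !mxE.
have -> : (fun N => A_ N k l) = fun N =>
    expR (f 0 k / N.+1%:R) * K k l + N.+1%:R * (expR (f 0 k / N.+1%:R) - 1) *+ (k == l).
  apply/funext => N; rewrite /A_ /P mul_diag_mx !mxE [_^-1 * f 0 k]mulrC.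
  by case: (k == l); rewrite ?mulr1n ?mulr0n; field.
apply: cvgD.
  by rewrite -[X in (_ --> X)%classic]mul1r; apply: cvgMl; apply: cvg_expR_divS.
by case: (k == l); rewrite ?mulr0n ?mulr1n; [apply: cvg_mul_expR_divS_sub1|apply: cvg_cst].
Qed.

Lemma mxexpD_scalar A c : mxexp (A + c%:M) = expR c *: mxexp A.
Proof.
apply/matrixP => i j; rewrite [RHS]mxE.
have lim := @cvg_trotter_diag A (const_mx c) i j; rewrite diag_const_mx in lim.
apply: (cvg_unique (@Rhausdorff R) lim) => {lim}.
suff powE N : (diag_mx (map_mx expR (N.+1%:R^-1 *: const_mx c)) *m (1 + N.+1%:R^-1 *: A)) ^+ N.+1
    = expR c *: (1 + N.+1%:R^-1 *: A) ^+ N.+1.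
rewrite /mkset; under eq_fun do rewrite powE mxE.
  by apply: cvgMr; apply: cvg_mxexp_pow.
rewrite scalemx_const map_const_mx diag_const_mx mul_scalar_mx exprmxZ -expRM_natl.
by rewrite mulrA mulfV // mul1r.
Qed.

End MatrixExponential.
Section NonnegativeMatrices.
Variable R : numDomainType.

Lemma mxOver_nnegX n (A : 'M[R]_n) k : A \is a mxOver Num.nneg -> A ^+ k \is a mxOver Num.nneg.
Proof.
move=> A0; elim: k => [|k IHk]; last by rewrite exprS mxOverM.
by apply/mxOverP => i j; rewrite expr0 mxE nnegrE ler0n.
Qed.

Lemma mulmx_gt0 m n p (A : 'M[R]_(m, n)) (B : 'M[R]_(n, p)) i k j :
  A \is a mxOver Num.nneg -> B \is a mxOver Num.nneg ->
  0 < A i k -> 0 < B k j -> 0 < (A *m B) i j.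
Proof.
move=> /mxOverP A0 /mxOverP B0 Aik Bkj; rewrite mxE (bigD1 k) //= ltr_pwDl ?mulr_gt0 //.
by apply: sumr_ge0 => l _; apply: mulr_ge0; [apply: A0|apply: B0].
Qed.

Lemma mxtrace_gt0 n (A : 'M[R]_n) i : A \is a mxOver Num.nneg -> 0 < A i i -> 0 < \tr A.
Proof.
move=> /mxOverP A0 Aii; rewrite /mxtrace (bigD1 i) //= ltr_pwDl //.
by apply: sumr_ge0 => j _; apply: A0.
Qed.

Lemma connect_exprmx_gt0 n (B : 'M[R]_n) i j : B \is a mxOver Num.nneg ->
  connect (fun k l => 0 < B k l) i j -> exists k, 0 < (B ^+ k) i j.
Proof.
move=> B0 /connectP[p ip ->]; exists (size p).
elim: p i ip => [|k p IHp] i /=; first by rewrite expr0 mxE eqxx.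
by move=> /andP[ik kp]; rewrite exprS; apply: (mulmx_gt0 B0 _ ik); [apply: mxOver_nnegX|apply: IHp].
Qed.

End NonnegativeMatrices.

Section PositiveExponential.
Variables (R : realType) (n : nat).
Implicit Types (A B : 'M[R]_n) (i j : 'I_n).

Lemma mxexp_ge_term B k i j : B \is a mxOver Num.nneg ->
  (k`!%:R)^-1 * (B ^+ k) i j <= mxexp B i j.
Proof.
move=> B0; have term_ge0 l : 0 <= (l`!%:R)^-1 * (B ^+ l) i j.
  by rewrite mulr_ge0 ?invr_ge0 //; apply: (mxOverP (mxOver_nnegX l B0)).
apply: (ler_cvg_to (cvg_cst _) (@cvg_exp_partial _ _ B i j)); exists k.+1 => //= N kN.
rewrite summxE (bigD1 (Ordinal kN)) //= mxE lerDl.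
by apply: sumr_ge0 => l _; rewrite mxE.
Qed.

Definition metzler A : Prop := forall i j, i != j -> 0 <= A i j.

Lemma metzler_shift A : metzler A -> exists2 c, 0 <= c & A + c%:M \is a mxOver Num.nneg.
Proof.
move=> A0; have c0 : 0 <= \sum_k `|A k k| by apply: sumr_ge0.
exists (\sum_k `|A k k|) => //; apply/mxOverP => i j; rewrite nnegrE !mxE.
have [<-|ij] := eqVneq i j; last by rewrite addr0 A0.
rewrite (bigD1 i) //= addrA addr_ge0 ?sumr_ge0 //.
by rewrite -lerBlDl sub0r -normrN ler_norm.
Qed.

Lemma mxexp_ge0 A : metzler A -> mxexp A \is a mxOver Num.nneg.
Proof.
move=> /metzler_shift[c _ B0]; apply/mxOverP => i j; rewrite nnegrE.
rewrite -(pmulr_rge0 _ (expR_gt0 c)); have /matrixP/(_ i j) := mxexpD_scalar A c.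
rewrite [X in _ = X -> _]mxE => <-; apply: le_trans (mxexp_ge_term 0 i j B0).
by rewrite mulr_ge0 ?invr_ge0 //; apply: (mxOverP (mxOver_nnegX 0 B0)).
Qed.

Lemma mxexp_gt0 A i j : metzler A -> connect (fun k l => 0 < A k l) i j -> 0 < mxexp A i j.
Proof.
move=> /metzler_shift[c c0 B0] ij; rewrite -(pmulr_rgt0 _ (expR_gt0 c)).
have /matrixP/(_ i j) := mxexpD_scalar A c; rewrite [X in _ = X -> _]mxE => <-.
have {}ij : connect (fun k l => 0 < (A + c%:M) k l) i j.
  apply: connect_sub ij => k l kl; apply: connect1.
  by rewrite !mxE ltr_wpDr // mulrn_wge0.
have [k Bk] := connect_exprmx_gt0 B0 ij.
by apply: lt_le_trans (mxexp_ge_term k i j B0); rewrite mulr_gt0 // invr_gt0 ltr0n fact_gt0.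
Qed.

End PositiveExponential.

(** * Equality constraints and spin flips *)

Lemma ler_sum_tagged (R : numDomainType) (A B K : finType) (P : pred A) (Q : pred B)
    (f : A -> R) (g : B -> R) (phi : A -> B) (tag : A -> K) :
  (forall b, Q b -> 0 <= g b) ->
  (forall a, P a -> Q (phi a)) ->
  (forall a, P a -> f a <= g (phi a)) ->
  {in P &, injective (fun a => (phi a, tag a))} ->
  \sum_(a | P a) f a <= #|K|%:R * \sum_(b | Q b) g b.
Proof.
move=> g0 PQ fg inj; apply: (@le_trans _ _ (\sum_(a | P a) g (phi a))); first exact: ler_sum.
rewrite (partition_big phi Q) //= mulr_sumr; apply: ler_sum => b Qb.
rewrite (eq_bigr (fun=> g b)) => [|a /andP[_ /eqP-> //]].
rewrite sumr_const -[leLHS]mulr_natl ler_wpM2r ?g0 // ler_nat.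
apply: (@leq_card_in _ _ tag) => a a' /andP[Pa /eqP phi_a] /andP[Pa' /eqP phi_a'] tag_aa'.
by apply: inj => //=; rewrite tag_aa' phi_a phi_a'.
Qed.

Section SpinFlips.
Variables (R : realType) (m : nat) (V : finType) (r : rel V) (eta : V -> R).
Hypothesis eta_ge0 : forall v, 0 <= eta v.
Implicit Types (s : {ffun V -> 'I_m.+1}) (u v w : V) (b : 'I_m.+1).

Definition symrel u v := r u v || r v u.
Definition compatible s := [forall u, forall v, r u v ==> (s u == s v)].
Definition weight s : R := expR (\sum_v eta v * spin_val R (s v)).
Definition component_mass u : R := \sum_(v | connect symrel u v) eta v.

Definition recolor s u b : {ffun V -> 'I_m.+1} :=
  [ffun v => if connect symrel u v then b else s v].

Definition merge s u v :=
  if (s u <= s v)%N then recolor s u (s v) else recolor s v (s u).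

(* What [merge s u v] forgets about [s]. *)
Definition merge_tag s u v : bool * 'I_m.+1 :=
  ((s u <= s v)%N, if (s u <= s v)%N then s u else s v).

Lemma compatibleP s : reflect (forall u v, r u v -> s u = s v) (compatible s).
Proof.
apply: (iffP forallP) => [rs u v ruv|rs u].
  by have /forallP/(_ v)/implyP/(_ ruv)/eqP := rs u.
by apply/forallP => v; apply/implyP => /rs ->.
Qed.

Lemma symrelC : connect_sym symrel.
Proof. by apply: sym_connect_sym => u v; rewrite /symrel orbC. Qed.

Lemma connect_symrel u v : r u v -> connect symrel u v.
Proof. by move=> ruv; apply: connect1; rewrite /symrel ruv. Qed.

Lemma compatible_connect s u v : compatible s -> connect symrel u v -> s u = s v.
Proof.
move=> /compatibleP rs /connectP[p]; elim: p u => [|w p IHp] u /= => [_ -> //|].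
by case/andP=> /orP[/rs->|/rs<-] wp vE; apply: IHp.
Qed.

Lemma recolor_compatible s u b : compatible s -> compatible (recolor s u b).
Proof.
move=> /compatibleP rs; apply/compatibleP => v w rvw; rewrite !ffunE (rs _ _ rvw).
by rewrite (same_connect_r symrelC (connect_symrel rvw)).
Qed.

Lemma recolorK s u b : compatible s -> recolor (recolor s u b) u (s u) = s.
Proof.
move=> cs; apply/ffunP => v; rewrite !ffunE.
by case uv: (connect _ _ _) => //; apply: compatible_connect uv.
Qed.

Lemma weight_recolor s u b : compatible s ->
  weight s = expR (- (b%:R - (s u)%:R) * component_mass u) * weight (recolor s u b).
Proof.
move=> cs; rewrite /weight -expRD; congr expR.
rewrite (bigID (connect symrel u)) [X in _ = _ + X](bigID (connect symrel u)) /= addrA.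
congr (_ + _); last by apply: eq_bigr => v /negbTE uv; rewrite ffunE uv.
rewrite mulr_sumr -big_split; apply: eq_bigr => v uv /=.
by rewrite ffunE uv (compatible_connect cs uv) /spin_val; ring.
Qed.

Lemma component_mass_ge0 u : 0 <= component_mass u.
Proof. exact: sumr_ge0. Qed.

Lemma weight_recolor_le s u b : compatible s -> (s u <= b)%N ->
  weight s <= weight (recolor s u b).
Proof.
move=> cs ub; rewrite [leLHS](weight_recolor u b cs) ler_piMl ?expR_ge0 // expR_le1.
by rewrite mulNr oppr_le0 mulr_ge0 ?component_mass_ge0 // subr_ge0 ler_nat.
Qed.

Lemma weight_recolor_gain s u b : compatible s -> (s u < b)%N ->
  weight s <= expR (- component_mass u) * weight (recolor s u b).
Proof.
move=> cs ub; rewrite [leLHS](weight_recolor u b cs) ler_wpM2r ?expR_ge0 // ler_expR.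
rewrite mulNr lerN2 ler_peMl ?component_mass_ge0 //.
by rewrite lerBrDr nat1r ler_nat.
Qed.

Lemma merge_compatible s u v : compatible s -> compatible (merge s u v).
Proof. by move=> cs; rewrite /merge; case: ifP => _; apply: recolor_compatible. Qed.

Lemma mergeE s u v w : compatible s -> connect symrel u w || connect symrel v w ->
  merge s u v w = if (s u <= s v)%N then s v else s u.
Proof.
move=> cs; rewrite /merge; case: ifP => _ uvw; rewrite ffunE.
  by case: ifP uvw => //= _ /(compatible_connect cs).
by rewrite orbC in uvw; case: ifP uvw => //= _ /(compatible_connect cs).
Qed.

Lemma merge_inj u v :
  {in compatible &, injective (fun s => (merge s u v, merge_tag s u v))}.
Proof.
move=> s s' cs cs' [] + uv_le; rewrite /merge -uv_le.
case: ifP => _ merge_eq tag_eq.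
  by rewrite -(recolorK u (s v) cs) merge_eq tag_eq recolorK.
by rewrite -(recolorK v (s u) cs) merge_eq tag_eq recolorK.
Qed.

Lemma weight_merge_le s u v : compatible s -> weight s <= weight (merge s u v).
Proof.
by move=> cs; rewrite /merge; case: leqP => suv; apply: weight_recolor_le => //; apply: ltnW.
Qed.

Lemma weight_merge_gain s u v (G : R) : compatible s -> s u != s v ->
  expR (- component_mass u) <= G -> expR (- component_mass v) <= G ->
  weight s <= G * weight (merge s u v).
Proof.
move=> cs suv uG vG; rewrite /merge; case: leqP => le_suv.
  have lt_suv : (s u < s v)%N by rewrite ltn_neqAle suv.
  by apply: le_trans (weight_recolor_gain cs lt_suv) _; rewrite ler_wpM2r ?expR_ge0.
by apply: le_trans (weight_recolor_gain cs le_suv) _; rewrite ler_wpM2r ?expR_ge0.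
Qed.

Lemma card_merge_tag : #|{: bool * 'I_m.+1}| = (2 * m.+1)%N.
Proof. by rewrite card_prod card_bool card_ord. Qed.

(* Raising the lower of the two components loses no weight. *)
Lemma sum_compatible_merge u v :
  \sum_(s | compatible s) weight s
    <= (2 * m.+1)%:R * \sum_(s | compatible s && (s u == s v)) weight s.
Proof.
rewrite -card_merge_tag.
apply: (ler_sum_tagged (phi := fun s => merge s u v) (tag := fun s => merge_tag s u v)).
- by move=> s _; apply: expR_ge0.
- by move=> s cs; rewrite merge_compatible //= !mergeE // connect0 ?orbT.
- by move=> s; apply: weight_merge_le.
- exact: merge_inj.
Qed.

End SpinFlips.

(** * Links in space-time *)

Section Links.
Variables (X : finType) (m M : nat).
Implicit Types (y z : X) (cut : {set X}).

(* [Some (a, b, true)] is a transposition link [T], [Some (a, b, false)] a [Q] link. *)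
Definition link : Type := option (X * X * bool).
Definition point : Type := 'I_M.+1 * X.
Definition before (k : 'I_M) : 'I_M.+1 := widen_ord (leqnSn M) k.
Definition after (k : 'I_M) : 'I_M.+1 := lift ord0 k.
Definition cut_end y : pred point := pred2 (ord0, y) (ord_max, y).

Implicit Types (l : link) (w : {ffun 'I_M -> link}) (s : {ffun point -> 'I_m.+1}).

Definition crosses l y z : bool :=
  match l with
  | Some (a, b, true) => [|| (y == a) && (z == b), (y == b) && (z == a)
                           | [&& y == z, y != a & y != b]]
  | Some (a, b, false) => [&& y == z, y != a & y != b]
  | None => y == z
  end.

Definition pairs l y z : bool :=
  if l is Some (a, b, false) then (y == a) && (z == b) else false.

Definition agree_outside (P : pred X) (c c' : {ffun X -> 'I_m.+1}) : bool :=
  [forall y, P y || (c y == c' y)].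

Definition step l (c c' : {ffun X -> 'I_m.+1}) : bool :=
  match l with
  | Some (a, b, true) => [&& c a == c' b, c b == c' a & agree_outside (pred2 a b) c c']
  | Some (a, b, false) => [&& c a == c b, c' a == c' b & agree_outside (pred2 a b) c c']
  | None => c == c'
  end.

Lemma agree_outsideP (P : pred X) (c c' : {ffun X -> 'I_m.+1}) :
  reflect (forall y, ~~ P y -> c y = c' y) (agree_outside P c c').
Proof.
apply: (iffP forallP) => [off y /negbTE Py|off y]; first by have := off y; rewrite Py => /eqP.
by case: (boolP (P y)) => //= Py; rewrite off.
Qed.

Lemma stepP l (c c' : {ffun X -> 'I_m.+1}) :
  reflect ((forall y z, crosses l y z -> c y = c' z) /\
           (forall y z, pairs l y z -> c y = c z /\ c' y = c' z)) (step l c c').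
Proof.
case: l => [[[a b] []]|] /=.
- apply: (iffP and3P) => [[/eqP cab /eqP cba /agree_outsideP off]|[cr _]].
    split=> // y z /or3P[/andP[/eqP-> /eqP->] // | /andP[/eqP-> /eqP->] // |].
    by case/and3P=> /eqP<- ya yb; apply: off; rewrite negb_or ya.
  split; try by apply/eqP/cr; rewrite !eqxx ?orbT.
  by apply/agree_outsideP => y; rewrite negb_or => yab; apply: cr; rewrite eqxx yab !orbT.
- apply: (iffP and3P) => [[/eqP cab /eqP c'ab /agree_outsideP off]|[cr pr]].
    split=> [y z /and3P[/eqP<- ya yb]|y z /andP[/eqP-> /eqP->] //].
    by apply: off; rewrite negb_or ya.
  have [cab c'ab] := pr a b (introT andP (conj (eqxx a) (eqxx b))).
  rewrite cab c'ab; split=> //; apply/agree_outsideP => y; rewrite negb_or => yab.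
  by apply: cr; rewrite eqxx yab.
- apply: (iffP eqP) => [->|[cr _]]; first by split => // y z /eqP->.
  by apply/ffunP => y; apply: cr.
Qed.

(* The last clause closes the time circle, except above the sites in [cut]. *)
Definition strel w cut (p q : point) : bool :=
  [exists k : 'I_M,
     [|| [&& p.1 == before k, q.1 == after k & crosses (w k) p.2 q.2],
         [&& p.1 == before k, q.1 == before k & pairs (w k) p.2 q.2]
       | [&& p.1 == after k, q.1 == after k & pairs (w k) p.2 q.2]]]
  || [&& p.1 == ord_max, q.1 == ord0, p.2 == q.2 & p.2 \notin cut].

Variant strel_spec w cut : point -> point -> Prop :=
  | StrelCross k y z of crosses (w k) y z : strel_spec w cut (before k, y) (after k, z)
  | StrelBefore k y z of pairs (w k) y z : strel_spec w cut (before k, y) (before k, z)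
  | StrelAfter k y z of pairs (w k) y z : strel_spec w cut (after k, y) (after k, z)
  | StrelWrap y of y \notin cut : strel_spec w cut (ord_max, y) (ord0, y).

Lemma strelP w cut (p q : point) : reflect (strel_spec w cut p q) (strel w cut p q).
Proof.
apply: (iffP orP) => [|[k y z wk|k y z wk|k y z wk|y cy]].
- case: p q => [i y] [j z] [/existsP[k]|/and4P[]] /=; last first.
    by move=> /eqP-> /eqP-> /eqP<- cy; apply: StrelWrap.
  by case/or3P => /and3P[/eqP-> /eqP-> wk];
    [apply: StrelCross|apply: StrelBefore|apply: StrelAfter].
- by left; apply/existsP; exists k; rewrite /= !eqxx wk.
- by left; apply/existsP; exists k; rewrite /= !eqxx wk orbT.
- by left; apply/existsP; exists k; rewrite /= !eqxx wk !orbT.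
- by right; rewrite /= !eqxx cy.
Qed.

Definition slice s (i : 'I_M.+1) : {ffun X -> 'I_m.+1} := [ffun y => s (i, y)].

Definition trajectory w s : bool :=
  [forall k, step (w k) (slice s (before k)) (slice s (after k))].

Lemma compatible_strelP w cut s :
  reflect (trajectory w s /\ forall y, y \notin cut -> s (ord_max, y) = s (ord0, y))
          (compatible (strel w cut) s).
Proof.
apply: (iffP (compatibleP _ _)) => [rs|[/forallP traj wrap] p q].
  split=> [|y cy]; last by apply/rs/strelP/StrelWrap.
  apply/forallP => k; apply/stepP; split=> y z wk; rewrite !ffunE.
    by apply/rs/strelP/StrelCross.
  by split; apply/rs/strelP; [apply: StrelBefore|apply: StrelAfter].
case/strelP => [k y z wk|k y z wk|k y z wk|y cy]; last exact: wrap.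
- by have /stepP[/(_ y z wk) + _] := traj k; rewrite !ffunE.
- by have /stepP[_ /(_ y z wk)[+ _]] := traj k; rewrite !ffunE.
- by have /stepP[_ /(_ y z wk)[_ +]] := traj k; rewrite !ffunE.
Qed.

Lemma cut_end0 y : cut_end y (ord0, y).
Proof. by rewrite /cut_end /= eqxx. Qed.

Lemma cut_end_max y : cut_end y (ord_max, y).
Proof. by rewrite /cut_end /= eqxx orbT. Qed.

Lemma compatible_strel_glue w cut s : compatible (strel w cut) s ->
  (forall y, y \in cut -> s (ord_max, y) = s (ord0, y)) -> compatible (strel w finset.set0) s.
Proof.
case/compatible_strelP=> traj wrap cut_wrap; apply/compatible_strelP; split=> // y _.
by have [/cut_wrap|/wrap] := boolP (y \in cut).
Qed.

End Links.

Section Domination.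
Variables (R : realType) (X : finType) (m M : nat).
Variable eta : point X M -> R.
Hypothesis eta_ge0 : forall p, 0 <= eta p.
Implicit Types (w : {ffun 'I_M -> link X}) (i k : 'I_M).

Definition spin_sum w : R :=
  \sum_(s | compatible (strel w finset.set0) s) weight eta (m := m) s.

Definition reset w i : {ffun 'I_M -> link X} := [ffun k => if k == i then None else w k].

Lemma spin_sum_ge0 w : 0 <= spin_sum w.
Proof. by apply: sumr_ge0 => s _; apply: expR_ge0. Qed.

(* One more equality makes the four spins around a link equal, so that the
   configuration is also compatible with the absence of the link. *)
Lemma trajectory_reset w i a b c (s : {ffun point X M -> 'I_m.+1}) :
  w i = Some (a, b, c) -> trajectory w s ->
  s (before i, a) = s (if c then (before i, b) else (after i, a)) -> trajectory (reset w i) s.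
Proof.
move=> wi /forallP traj s_eq; apply/forallP => k; rewrite ffunE.
case: eqP => [->|_]; last exact: traj.
apply/eqP/ffunP => y; rewrite !ffunE; have := traj i; rewrite wi.
case: c {wi} s_eq => s_eq /and3P[]; rewrite !ffunE => /eqP ? /eqP ? /agree_outsideP /(_ y);
  rewrite !ffunE /= negb_or => off;
  have [->|ya] := eqVneq y a; try (by congruence);
  have [->|yb] := eqVneq y b; try (by congruence); by rewrite off ?ya.
Qed.

Lemma spin_sum_reset w i : spin_sum w <= (2 * m.+1)%:R * spin_sum (reset w i).
Proof.
case wi : (w i) => [[[a b] c]|]; last first.
  have -> : reset w i = w by apply/ffunP => k; rewrite ffunE; case: eqP => // ->.
  by rewrite ler_peMl ?spin_sum_ge0 // ler1n.
pose p : point X M := (before i, a).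
pose q : point X M := if c then (before i, b) else (after i, a).
have merge_le := @sum_compatible_merge R m _ (strel w finset.set0) eta eta_ge0 p q.
apply: le_trans merge_le _.
apply: ler_wpM2l => //; rewrite [leLHS]big_mkcond [leRHS]big_mkcond.
apply: ler_sum => s _; case: ifP => [/andP[/compatible_strelP[traj wrap] /eqP spq]|_].
  rewrite ifT //; apply/compatible_strelP; split=> //.
  exact: trajectory_reset wi traj spq.
by case: ifP => // _; apply: expR_ge0.
Qed.

Variable wt : link X -> R.
Hypothesis wt_ge0 : forall l, 0 <= wt l.
Hypothesis wt_None_gt0 : 0 < wt None.

Definition link_prod w : R := \prod_k wt (w k).
Definition link_measure w : R := link_prod w * spin_sum w.

Lemma link_prod_ge0 w : 0 <= link_prod w.
Proof. by apply: prodr_ge0 => k _; apply: wt_ge0. Qed.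

Lemma link_measure_ge0 w : 0 <= link_measure w.
Proof. by rewrite mulr_ge0 ?link_prod_ge0 ?spin_sum_ge0. Qed.

Lemma link_prod_reset w i : link_prod w = wt (w i) / wt None * link_prod (reset w i).
Proof.
rewrite /link_prod (bigD1 i) //= [in RHS](bigD1 i) //= ffunE eqxx mulrA divfK ?gt_eqF //.
by congr (_ * _); apply: eq_bigr => k /negbTE ki; rewrite ffunE ki.
Qed.

Lemma link_measure_reset w i :
  link_measure w <= (2 * m.+1)%:R * wt (w i) / wt None * link_measure (reset w i).
Proof.
rewrite /link_measure (link_prod_reset w i).
have -> : (2 * m.+1)%:R * wt (w i) / wt None * (link_prod (reset w i) * spin_sum (reset w i)) =
    wt (w i) / wt None * link_prod (reset w i) * ((2 * m.+1)%:R * spin_sum (reset w i)) by ring.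
rewrite ler_wpM2l ?spin_sum_reset // mulr_ge0 ?link_prod_ge0 //.
by rewrite divr_ge0 // ltW.
Qed.

Lemma reset_inj i l : {in [pred w : {ffun 'I_M -> link X} | w i == l] &, injective (reset^~ i)}.
Proof.
move=> w w' /eqP wi /eqP w'i /ffunP ww'; apply/ffunP => k; have := ww' k; rewrite !ffunE.
by case: eqP => // ->; rewrite wi w'i.
Qed.

Lemma sum_fixed_link_le (P : pred {ffun 'I_M -> link X}) i l :
  (forall w, P w -> P (reset w i)) ->
  \sum_(w : {ffun 'I_M -> link X} | (w i == l) && P w) link_measure w <=
  (2 * m.+1)%:R * wt l / wt None * \sum_(w | P w) link_measure w.
Proof.
move=> P_reset; set q := _ * _ / _.
have q0 : 0 <= q by rewrite !mulr_ge0 ?invr_ge0 ?(ltW wt_None_gt0).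
rewrite mulr_sumr -[leRHS]mul1r -[1](_ : #|{: unit}|%:R = 1); last by rewrite card_unit.
apply: (ler_sum_tagged (phi := reset^~ i) (tag := fun=> tt)).
- by move=> w _; rewrite mulr_ge0 ?link_measure_ge0.
- by move=> w /andP[_ /P_reset].
- by move=> w /andP[/eqP wi _]; have := link_measure_reset w i; rewrite wi.
- by move=> w w' /andP[wi _] /andP[w'i _] []; apply: reset_inj wi w'i.
Qed.

Definition bond : Type := 'I_M * (X * X).
Implicit Types (t : bond) (c : seq bond).

Definition occupied w t : bool :=
  (w t.1 == Some (t.2, true)) || (w t.1 == Some (t.2, false)).

Definition edge_weight (e : X * X) : R := wt (Some (e, true)) + wt (Some (e, false)).

Lemma occupied_reset w i t : t.1 != i -> occupied (reset w i) t = occupied w t.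
Proof. by rewrite /occupied ffunE => /negbTE->. Qed.

Lemma sum_occupied_cons_le c t : t.1 \notin map fst c ->
  \sum_(w | all (occupied w) (t :: c)) link_measure w <=
  (2 * m.+1)%:R * edge_weight t.2 / wt None * \sum_(w | all (occupied w) c) link_measure w.
Proof.
move=> tc; have reset_occ w : all (occupied w) c -> all (occupied (reset w t.1)) c.
  move=> occ; apply/allP => t' t'c; rewrite occupied_reset ?(allP occ) //.
  by apply: contraNneq tc => <-; apply: map_f.
pose fixed v (w : {ffun 'I_M -> link X}) := (w t.1 == Some (t.2, v)) && all (occupied w) c.
have -> : \sum_(w | all (occupied w) (t :: c)) link_measure w =
    \sum_(w | fixed true w) link_measure w + \sum_(w | fixed false w) link_measure w.
  rewrite (bigID (fun w : {ffun 'I_M -> link X} => w t.1 == Some (t.2, true))) /=.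
  congr (_ + _); apply: eq_bigl => w; rewrite /occupied /fixed.
    by case: eqP; rewrite ?andbT ?andbF.
  by case: eqP => [->|_] /=; rewrite ?andbT ?andbF //=; case: eqP.
by rewrite /edge_weight mulrDr !mulrDl; apply: lerD; apply: sum_fixed_link_le.
Qed.

Lemma sum_occupied_le c delta : (forall e, edge_weight e <= delta) -> uniq (map fst c) ->
  \sum_(w | all (occupied w) c) link_measure w
    <= ((2 * m.+1)%:R * delta / wt None) ^+ size c * \sum_w link_measure w.
Proof.
move=> wt_le; elim: c => [|t c IHc]; first by rewrite expr0 mul1r.
move=> /= /andP[tc /IHc{}IHc]; apply: le_trans (sum_occupied_cons_le tc) _.
have wt_inv0 : 0 <= (wt None)^-1 by rewrite invr_ge0 ltW.
have delta0 : 0 <= delta by apply: le_trans (wt_le t.2); apply: addr_ge0.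
rewrite exprS -[leRHS]mulrA; apply: (@le_trans _ _ ((2 * m.+1)%:R * delta / wt None *
    \sum_(w | all (occupied w) c) link_measure w)); last by rewrite ler_wpM2l ?mulr_ge0.
apply: ler_wpM2r; first by apply: sumr_ge0 => w _; apply: link_measure_ge0.
by rewrite ler_wpM2r ?ler_wpM2l.
Qed.

End Domination.

(** * Cutting the time circle above two sites *)

Section Parity.
Variables (X : finType) (M : nat) (ed : rel X) (w : {ffun 'I_M -> link X}).
Hypothesis ed_irr : irreflexive ed.
Implicit Types (cut : {set X}) (chi : pred (point X M)).

Definition valid_link (l : link X) : bool := if l is Some (a, b, _) then ed a b else true.
Definition valid_links : Prop := forall k, valid_link (w k).

Hypothesis w_valid : valid_links.

Lemma parity_step cut chi k : (forall p q, strel w cut p q -> chi p = chi q) ->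
  \big[addb/false]_y chi (before k, y) = \big[addb/false]_y chi (after k, y).
Proof.
move=> chi_r; have := w_valid k.
have chi_cross y z : crosses (w k) y z -> chi (before k, y) = chi (after k, z).
  by move=> wk; apply/chi_r/strelP/StrelCross.
have chi_before y z : pairs (w k) y z -> chi (before k, y) = chi (before k, z).
  by move=> wk; apply/chi_r/strelP/StrelBefore.
have chi_after y z : pairs (w k) y z -> chi (after k, y) = chi (after k, z).
  by move=> wk; apply/chi_r/strelP/StrelAfter.
case: (w k) chi_cross chi_before chi_after => [[[a b] []]|] /= chi_cross chi_before chi_after ed_ab.
- rewrite [RHS](reindex_inj (@perm_inj _ (tperm a b))); apply: eq_bigr => y _ /=.
  apply: chi_cross; case: tpermP => [->|->|/eqP ya /eqP yb]; rewrite ?eqxx ?orbT //.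
  by rewrite ya yb !orbT.
- have ba : b != a by apply: contraTneq ed_ab => ->; rewrite ed_irr.
  rewrite (bigD1 a) //= (bigD1 b) //= [RHS](bigD1 a) //= [X in _ = _ (+) X](bigD1 b) //= !addbA.
  rewrite (chi_before a b) ?(chi_after a b) ?eqxx // !addbb; congr (_ (+) _).
  by apply: eq_bigr => y /andP[ya yb]; apply: chi_cross; rewrite eqxx ya.
- by apply: eq_bigr => y _; apply: chi_cross.
Qed.

Lemma parity_cut cut chi : (forall p q, strel w cut p q -> chi p = chi q) ->
  \big[addb/false]_(y in cut) chi (ord0, y) = \big[addb/false]_(y in cut) chi (ord_max, y).
Proof.
move=> chi_r; have level i : \big[addb/false]_y chi (ord0, y) = \big[addb/false]_y chi (i, y).
  case: i; elim=> [|n IHn] lt_n; first by apply: eq_bigr => y _; congr (chi (_, y)); apply: val_inj.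
  rewrite (IHn (ltnW lt_n)); have lt_nM : (n < M)%N by [].
  have -> : Ordinal (ltnW lt_n) = before (Ordinal lt_nM) by apply: val_inj.
  have -> : Ordinal lt_n = after (Ordinal lt_nM) by apply: val_inj.
  exact: parity_step chi_r.
have := level ord_max; rewrite (bigID (mem cut)) [RHS](bigID (mem cut)) /=.
rewrite [X in _ (+) X = _ -> _](eq_bigr (fun y => chi (ord_max, y))); first exact: addIb.
by move=> y cy; apply/esym/chi_r/strelP/StrelWrap.
Qed.

Lemma connect_other_cut a b (p : point X M) : a != b -> cut_end a p ->
  ~~ connect (symrel (strel w [set a; b])) (ord0, a) (ord_max, a) ->
  connect (symrel (strel w [set a; b])) p (ord0, b)
    || connect (symrel (strel w [set a; b])) p (ord_max, b).
Proof.
move=> ab p_a a_cut; pose chi := connect (symrel (strel w [set a; b])) p.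
have chi_r q q' : strel w [set a; b] q q' -> chi q = chi q'.
  by move=> qq'; apply: (same_connect_r (symrelC _)); apply: connect_symrel.
have := parity_cut chi_r; rewrite !big_setU1 ?inE //= !big_set1 -!/(chi _).
have -> : chi (ord_max, a) = ~~ chi (ord0, a).
  by rewrite /chi; case/pred2P: p_a => ->; rewrite connect0 ?(negbTE a_cut) // symrelC a_cut.
by do 3!case: (chi _).
Qed.

End Parity.

Section CutSum.
Variables (R : realType) (X : finType) (m M : nat) (ed : rel X).
Variables (w : {ffun 'I_M -> link X}) (a b : X) (eta : point X M -> R).
Hypothesis ed_irr : irreflexive ed.
Hypothesis w_valid : valid_links ed w.
Hypothesis ab : a != b.
Hypothesis eta_ge0 : forall p, 0 <= eta p.
Local Notation r := (strel w [set a; b]).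
Implicit Types (s : {ffun point X M -> 'I_m.+1}).

Definition jumps s y : bool := s (ord0, y) != s (ord_max, y).

Definition cut_sum : R :=
  \sum_(s | [&& compatible r s, jumps s a & jumps s b]) weight eta (m := m) s.

Lemma jump_not_connect s y : compatible r s -> jumps s y ->
  ~~ connect (symrel r) (ord0, y) (ord_max, y).
Proof. by move=> cs; apply: contra => /(compatible_connect cs)->. Qed.

(* By parity the components of the two ends of the cut at [a] contain both ends
   of the cut at [b], so merging them closes both cuts. *)
Lemma merge_closes_cuts s : compatible r s -> jumps s a -> jumps s b ->
  compatible (strel w finset.set0) (merge r s (ord0, a) (ord_max, a)).
Proof.
move=> cs ja jb; apply: compatible_strel_glue (merge_compatible _ _ cs) _ => y.
have reaches_b q : cut_end b q ->
    connect (symrel r) (ord0, a) q || connect (symrel r) (ord_max, a) q.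
  move=> q_b; rewrite ![connect _ (_, a) q]symrelC.
  have := @connect_other_cut X M ed w ed_irr w_valid b a q.
  rewrite eq_sym finset.setUC => /(_ ab q_b); apply.
  exact: jump_not_connect cs jb.
rewrite !inE => /orP[] /eqP->; rewrite !mergeE ?connect0 ?orbT //;
  by apply: reaches_b; rewrite ?cut_end0 ?cut_end_max.
Qed.

Lemma cut_sum_le (G : R) : 0 <= G ->
  (forall p : point X M, cut_end a p ->
     connect (symrel r) p (ord0, b) || connect (symrel r) p (ord_max, b) ->
     expR (- component_mass r eta p) <= G) ->
  cut_sum <= (2 * m.+1)%:R * (G * spin_sum m eta w).
Proof.
move=> G0 mass_le; rewrite -(card_merge_tag m) mulr_sumr.
apply: (ler_sum_tagged (phi := fun s => merge r s (ord0, a) (ord_max, a))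
  (tag := fun s => merge_tag s (ord0, a) (ord_max, a))).
- by move=> s _; rewrite mulr_ge0 ?expR_ge0.
- by move=> s /and3P[]; apply: merge_closes_cuts.
- move=> s /and3P[cs ja _]; have a_cut := jump_not_connect cs ja.
  apply: weight_merge_gain => //; apply: mass_le; rewrite ?cut_end0 ?cut_end_max //;
    by apply: (connect_other_cut ed_irr w_valid ab _ a_cut); rewrite ?cut_end0 ?cut_end_max.
- by move=> s s' /and3P[cs _ _] /and3P[cs' _ _]; apply: merge_inj.
Qed.

End CutSum.

(** * Chains of links *)

Section CircleDistance.
Variable M : nat.
Implicit Types a b c : nat.

(* Distance on the time circle of length [M]; the levels [0] and [M] coincide. *)
Definition cdist a b : nat := minn (maxn a b - minn a b) (M - (maxn a b - minn a b)).

Lemma cdistC a b : cdist a b = cdist b a.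
Proof. by rewrite /cdist; lia. Qed.

Lemma cdist_triangle a b c : (a <= M)%N -> (b <= M)%N -> (c <= M)%N ->
  (cdist a c <= cdist a b + cdist b c)%N.
Proof. by rewrite /cdist; lia. Qed.

Lemma cdistS a : (cdist a a.+1 <= 1)%N.
Proof. by rewrite /cdist; lia. Qed.

Lemma cdistxx a : cdist a a = 0%N.
Proof. by rewrite /cdist; lia. Qed.

Lemma cdist_top : cdist M 0 = 0%N.
Proof. by rewrite /cdist; lia. Qed.

Lemma cdist_le a b : (a <= M)%N -> (b <= M)%N -> (cdist a b <= M)%N.
Proof. by rewrite /cdist; lia. Qed.

Variables (R : realType) (kappa : R).
Hypothesis kappa_gt0 : 0 < kappa.

Lemma expRN_lt1 : expR (- kappa) < 1.
Proof. by rewrite expR_lt1 oppr_lt0. Qed.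

(* Each distance is attained at most four times. *)
Lemma sum_expR_cdist_le (j : 'I_M) :
  \sum_(i < M) expR (- kappa * (cdist j i)%:R) <= 4 / (1 - expR (- kappa)).
Proof.
have phiE (i : 'I_M) : (inord (cdist j i) : 'I_M.+1) = cdist j i :> nat.
  by rewrite inordK // ltnS cdist_le // ltnW.
have geometric_le : \sum_(k < M.+1) expR (- kappa) ^+ k <= (1 - expR (- kappa))^-1.
  have -> : \sum_(k < M.+1) expR (- kappa) ^+ k = series (geometric 1 (expR (- kappa))) M.+1.
    by rewrite /series /= big_mkord; apply: eq_bigr => k _; rewrite mul1r.
  rewrite -[leRHS]mul1r geometric_le_lim ?expR_gt0 //.
  by rewrite ger0_norm ?expR_ge0 ?expRN_lt1.
apply: le_trans (ler_wpM2l (ler0n _ 4) geometric_le).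
rewrite [4%:R](_ : _ = #|{: bool * bool}|%:R); last by rewrite card_prod card_bool.
apply: (ler_sum_tagged (phi := fun i : 'I_M => inord (cdist j i) : 'I_M.+1)
  (tag := fun i : 'I_M => ((i <= j)%N, (2 * (maxn j i - minn j i) <= M)%N))).
- by move=> k _; rewrite exprn_ge0 ?expR_ge0.
- by [].
- by move=> i _; rewrite phiE expRM_natr.
- move=> i i' _ _ [] /(congr1 val) /=; rewrite !phiE => cdist_eq le_eq half_eq.
  apply: val_inj => /=; move: cdist_eq le_eq half_eq; rewrite /cdist.
  by have := ltn_ord i; have := ltn_ord i'; have := ltn_ord j; lia.
Qed.

End CircleDistance.

Section Chains.
Variables (X : finType) (M : nat) (ed : rel X).
Implicit Types (e : X * X) (t : bond X M) (c : seq (bond X M)).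

Definition incident e (y : X) : bool := (y == e.1) || (y == e.2).
Definition meets e e' : bool := incident e e'.1 || incident e e'.2.
Definition degree_le D : Prop := forall e, (#|[pred e' | ed e'.1 e'.2 && meets e e']| <= D)%N.
Definition lipschitz_nat (f : X -> nat) : Prop :=
  forall a b, symrel ed a b -> (f a <= (f b).+1)%N.
Definition follows t t' : bool := ed t'.2.1 t'.2.2 && meets t.2 t'.2.

Fixpoint travel (j : nat) c : nat :=
  if c is t :: c' then cdist M j t.1 + travel t.1 c' else 0.

Lemma travel_cat t c c' : travel t.1 (c ++ c') = (travel t.1 c + travel (last t c).1 c')%N.
Proof. by elim: c t => //= t' c IHc t; rewrite IHc addnA. Qed.

Variable f : X -> nat.
Hypothesis f_lip : lipschitz_nat f.

Lemma lip_chain n t c y : (forall z, incident t.2 z -> (f z <= n)%N) ->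
  path follows t c -> incident (last t c).2 y -> (f y <= n + size c)%N.
Proof.
elim: c t n => [|t' c IHc] t n t_le /=; first by rewrite addn0 => _ /t_le.
move=> /andP[/andP[ed_t' tt'] t'c] /(IHc t' n.+1 _ t'c); rewrite addnS addSn; apply=> z.
have le12 := f_lip (introT orP (or_introl ed_t')).
have le21 := f_lip (introT orP (or_intror ed_t')).
by case/orP: tt' => /t_le f_le /orP[] /eqP->; lia.
Qed.

End Chains.

Section ChainExtraction.
Variables (X : finType) (M : nat) (ed : rel X).
Variables (w : {ffun 'I_M.+1 -> link X}) (cut : {set X}) (o : X).
Hypothesis w_valid : valid_links ed w.
Local Notation r := (strel w cut).
Implicit Types (p q : point X M.+1) (t : bond X M.+1) (c : seq (bond X M.+1)).

Definition root_bond : bond X M.+1 := (ord0, (o, o)).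

Lemma travel_root_cat c c' :
  travel 0 (c ++ c') = (travel 0 c + travel (last root_bond c).1 c')%N.
Proof. exact: (travel_cat root_bond). Qed.

Definition touches t p : bool :=
  incident t.2 p.2 && ((p.1 == t.1 :> nat) || (p.1 == t.1.+1 :> nat)).

Lemma occupied_inj t t' : occupied w t -> occupied w t' -> t.1 = t'.1 -> t = t'.
Proof.
case: t t' => [k e] [k' e'] /= + + kk'; rewrite /occupied /= kk'.
by case/orP => /eqP-> /orP[] // /eqP[->].
Qed.

Lemma occupied_edge t : occupied w t -> ed t.2.1 t.2.2.
Proof.
case: t => k [a b]; rewrite /occupied /= => wk; have := w_valid k.
by case/orP: wk => /eqP->.
Qed.

Lemma crosses_occupied k y z : crosses (w k) y z ->
  y = z \/ exists e, [/\ occupied w (k, e), incident e y & incident e z].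
Proof.
rewrite /occupied /incident; case: (w k) => [[[a b] [|]]|] /=; last by move/eqP; left.
  case/or3P => [/andP[/eqP-> /eqP->]|/andP[/eqP-> /eqP->]|/and3P[/eqP-> _ _]]; last by left.
  - by right; exists (a, b); rewrite !eqxx orbT.
  - by right; exists (a, b); rewrite !eqxx orbT.
by case/and3P => /eqP; left.
Qed.

Lemma pairs_occupied k y z : pairs (w k) y z ->
  exists e, [/\ occupied w (k, e), incident e y & incident e z].
Proof.
rewrite /occupied /incident; case: (w k) => [[[a b] []]|] //= /andP[/eqP-> /eqP->].
by exists (a, b); rewrite /= !eqxx !orbT.
Qed.

Lemma touches_before k e y : incident e y -> touches (k, e) (before k, y).
Proof. by rewrite /touches /= => ->; rewrite eqxx. Qed.

Lemma touches_after k e y : incident e y -> touches (k, e) (after k, y).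
Proof. by rewrite /touches /= => ->; rewrite eqxx orbT. Qed.

Lemma touches_cdist t p : touches t p -> (cdist M.+1 t.1 p.1 <= 1)%N.
Proof. by case/andP=> _ /orP[] /eqP->; rewrite ?cdistxx ?cdistS. Qed.

Lemma symrel_bond p q : symrel r p q ->
  (p.2 = q.2 /\ (cdist M.+1 p.1 q.1 <= 1)%N) \/
  exists2 t, occupied w t & touches t p && touches t q.
Proof.
suff half p' q' : r p' q' -> (p'.2 = q'.2 /\ (cdist M.+1 p'.1 q'.1 <= 1)%N) \/
    exists2 t, occupied w t & touches t p' && touches t q'.
  case/orP=> /half // [[qp d]|[t occ_t]]; first by left; split=> //; rewrite cdistC.
  by rewrite andbC; right; exists t.
case/strelP => {p' q'} [k y z|k y z|k y z|y _]; last by left; rewrite cdist_top.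
- case/crosses_occupied => [->|[e [ok ey ez]]]; first by left; rewrite cdistS.
  by right; exists (k, e); rewrite ?touches_before ?touches_after.
- by case/pairs_occupied => e [ok ey ez]; right; exists (k, e); rewrite ?touches_before.
- by case/pairs_occupied => e [ok ey ez]; right; exists (k, e); rewrite ?touches_after.
Qed.

Definition reached n p : Prop :=
  exists c, [/\ path (follows ed) root_bond c, uniq (map fst c), all (occupied w) c,
    incident (last root_bond c).2 p.2
    & (travel 0 c + cdist M.+1 (last root_bond c).1 p.1 <= 2 * n)%N].

Lemma level_le p : (p.1 <= M.+1)%N.
Proof. by rewrite -ltnS. Qed.

Lemma slot_le t : (t.1 <= M.+1)%N.
Proof. exact: ltnW. Qed.

Lemma reached_same_site n p q : p.2 = q.2 -> (cdist M.+1 p.1 q.1 <= 1)%N ->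
  reached n p -> reached n.+1 q.
Proof.
move=> pq d [c [path_c uniq_c occ_c inc_c cost_c]]; exists c; rewrite -pq; split=> //.
have := cdist_triangle (slot_le (last root_bond c)) (level_le p) (level_le q); lia.
Qed.

Lemma reached_bond n p q t : occupied w t -> touches t p -> touches t q ->
  reached n p -> reached n.+1 q.
Proof.
move=> occ_t touch_p touch_q [c [path_c uniq_c occ_c inc_c cost_c]].
have [dist_p dist_q] := (touches_cdist touch_p, touches_cdist touch_q).
have [inc_p inc_q] : incident t.2 p.2 /\ incident t.2 q.2.
  by case/andP: touch_p touch_q => [? _] /andP[].
have [/mapP[t' t'c tt']|new_slot] := boolP (t.1 \in map fst c).
  (* The slot of [t] is already visited: cut the chain back to that visit. *)
  have {tt'}t_t' := occupied_inj (allP occ_c _ t'c) occ_t (esym tt').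
  move: path_c uniq_c occ_c cost_c; case/splitPr: t'c => c1 c2; rewrite t_t' -cat_rcons.
  rewrite cat_path map_cat cat_uniq all_cat => /andP[path_c _] /andP[uniq_c _] /andP[occ_c _].
  rewrite travel_root_cat => cost_c.
  by exists (rcons c1 t); split; rewrite ?last_rcons //; lia.
exists (rcons c t); rewrite last_rcons; split=> //.
- rewrite rcons_path path_c /follows occupied_edge // /meets.
  by case/orP: inc_p (inc_c) => /eqP <- ->; rewrite ?orbT.
- by rewrite map_rcons rcons_uniq new_slot.
- by rewrite all_rcons occ_t.
- rewrite -cats1 travel_root_cat /= addn0.
  have := cdist_triangle (slot_le (last root_bond c)) (level_le p) (slot_le t).
  by rewrite [cdist _ p.1 t.1]cdistC; lia.
Qed.

Lemma reached_path p s : cut_end o p -> path (symrel r) p s ->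
  reached (size s) (last p s).
Proof.
move=> p_o; elim/last_ind: s => [_|s q IHs] /=.
  exists [::]; split=> //; case/pred2P: p_o => -> /=; rewrite /incident ?eqxx //.
  by rewrite cdistC cdist_top.
rewrite rcons_path size_rcons last_rcons => /andP[/IHs reach_s].
case/symrel_bond => [[pq dist_pq]|[t occ_t /andP[touch_p touch_q]]].
  exact: reached_same_site reach_s.
exact: reached_bond occ_t touch_p touch_q reach_s.
Qed.

Lemma connect_chain (f : X -> nat) p q :
  lipschitz_nat ed f -> f o = 0%N -> cut_end o p -> connect (symrel r) p q ->
  exists c : (f q.2).-tuple (bond X M.+1), [/\ path (follows ed) root_bond c,
    uniq (map fst c), all (occupied w) c & (travel 0 c <= 2 * #|connect (symrel r) p|)%N].
Proof.
move=> f_lip fo p_o /connectP[s0 p_s0 ->]; case/shortenP: p_s0 => s p_s uniq_s _.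
have size_s : (size s < #|connect (symrel r) p|)%N.
  rewrite -[(size s).+1]/(size (p :: s)) -(card_uniqP uniq_s).
  by apply: subset_leq_card; apply/fintype.subsetP => z; apply: path_connect.
have [c [path_c uniq_c occ_c inc_c cost_c]] := reached_path p_o p_s.
set n := f _; have n_le : (n <= size c)%N.
  rewrite -[size c]add0n; apply: (lip_chain f_lip _ path_c inc_c) => z.
  by rewrite /incident orbb => /eqP->; rewrite fo.
have size_take : size (take n c) == n by rewrite size_takel.
exists (Tuple size_take); rewrite /=.
have := cat_take_drop n c; move: (take n c) (drop n c) => c1 c2 cE.
move: path_c uniq_c occ_c cost_c; rewrite -cE cat_path map_cat cat_uniq all_cat travel_root_cat.
move=> /andP[-> _] /andP[-> _] /andP[-> _]; rewrite -addnA => cost_c; split=> //.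
by apply: leq_trans (leq_trans (leq_addr _ _) cost_c) _; rewrite leq_mul2l /= ltnW.
Qed.

End ChainExtraction.

Lemma sum_tuple_cons (V : nmodType) (T : finType) n (F : n.+1.-tuple T -> V) :
  \sum_c F c = \sum_t \sum_(c : n.-tuple T) F [tuple of t :: c].
Proof.
rewrite pair_big (reindex (fun p : T * n.-tuple T => [tuple of p.1 :: p.2])) //=.
exists (fun c : n.+1.-tuple T => (thead c, [tuple of behead c])) => [[t c]|c] _ /=.
  by congr (_, _); apply: val_inj.
by case/tupleP: c => t c; apply: val_inj.
Qed.

Section ChainEntropy.
Variables (R : realType) (X : finType) (M : nat) (ed : rel X) (kappa : R) (D : nat).
Hypothesis kappa_gt0 : 0 < kappa.
Hypothesis ed_degree : degree_le ed D.

Definition bond_entropy : R := D%:R * (4 / (1 - expR (- kappa))).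

Lemma bond_entropy_ge0 : 0 <= bond_entropy.
Proof. by rewrite mulr_ge0 // divr_ge0 // subr_ge0 ltW // expRN_lt1. Qed.

Lemma sum_follows_le (t : bond X M) :
  \sum_(t' | follows ed t t') expR (- kappa * (cdist M t.1 t'.1)%:R) <= bond_entropy.
Proof.
rewrite -(pair_big xpredT (fun e : X * X => ed e.1 e.2 && meets t.2 e)
  (fun (i : 'I_M) _ => expR (- kappa * (cdist M t.1 i)%:R))) /=.
apply: (@le_trans _ _ (D%:R * \sum_(i < M) expR (- kappa * (cdist M t.1 i)%:R))).
  rewrite mulr_sumr; apply: ler_sum => i _.
  by rewrite sumr_const -[leLHS]mulr_natl ler_wpM2r ?expR_ge0 // ler_nat ed_degree.
by rewrite ler_wpM2l // sum_expR_cdist_le.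
Qed.

Lemma sum_chains_le n (t : bond X M) :
  \sum_(c : n.-tuple (bond X M) | path (follows ed) t c) expR (- kappa * (travel t.1 c)%:R)
    <= bond_entropy ^+ n.
Proof.
elim: n t => [|n IHn] t.
  rewrite big_mkcond (eq_bigr (fun=> 1)); last by move=> c _; rewrite tuple0 /= mulr0 expR0.
  by rewrite sumr_const card_tuple expn0.
rewrite big_mkcond sum_tuple_cons exprS.
apply: le_trans (ler_wpM2r (exprn_ge0 n bond_entropy_ge0) (sum_follows_le t)).
rewrite mulr_suml [leRHS]big_mkcond; apply: ler_sum => t' _ /=.
case: ifP => _ /=; last by rewrite big1.
rewrite -big_mkcond; apply: le_trans (ler_wpM2l (expR_ge0 _) (IHn t')).
by rewrite mulr_sumr; apply: ler_sum => c _; rewrite natrD mulrDr expRD.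
Qed.

End ChainEntropy.

Section ComponentMass.
Variables (R : realType) (X : finType) (M : nat) (eta : point X M.+1 -> R) (eta0 : R).
Hypothesis eta_ge0 : forall p, 0 <= eta p.
Hypothesis eta0_ge0 : 0 <= eta0.
Hypothesis eta_ge : forall p, p.1 != ord_max -> eta0 <= eta p.
Variables (K : {pred point X M.+1}) (cut : {set X}).
Hypothesis K_wrap : forall y, y \notin cut -> (ord_max, y) \in K -> (ord0, y) \in K.

Lemma card_wrapped_le : (#|K| <= 2 * #|[pred p in K | p.1 != ord_max]| + #|cut|)%N.
Proof.
rewrite -(cardID [pred p | p.1 != ord_max] K).
have -> : #|[predI K & [pred p | p.1 != ord_max]]| = #|[pred p in K | p.1 != ord_max]|.
  by apply: eq_card => p; rewrite !inE.
rewrite mul2n -addnn -addnA leq_add2l.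
pose to_top (p : point X M.+1) : point X M.+1 := (ord_max, p.2).
apply: leq_trans (leq_add (leq_imset_card to_top _) (leq_imset_card (pair ord_max) (mem cut))).
apply: leq_trans (leq_of_leqif (leq_card_setU _ _)); apply: subset_leq_card.
apply/fintype.subsetP => -[i y]; rewrite !inE /= negbK => /andP[/eqP-> Ky].
have [cy|cy] := boolP (y \in cut); first by rewrite imset_f ?orbT.
apply/orP; left; apply/imsetP; exists (ord0, y) => //.
by rewrite inE K_wrap.
Qed.

Lemma wrapped_mass_ge : eta0 * ((#|K|%:R - #|cut|%:R) / 2) <= \sum_(p in K) eta p.
Proof.
rewrite (bigID (fun p : point X M.+1 => p.1 != ord_max)) /=.
apply: (@le_trans _ _ (\sum_(p in K | p.1 != ord_max) eta p)); last first.
  by rewrite lerDl sumr_ge0.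
apply: (@le_trans _ _ (\sum_(p in K | p.1 != ord_max) eta0)); last first.
  by apply: ler_sum => p /andP[_ /eta_ge].
rewrite sumr_const -[leRHS]mulr_natr ler_wpM2l //.
rewrite ler_pdivrMr // lerBlDr -natrM -natrD ler_nat mulnC.
exact: card_wrapped_le.
Qed.

End ComponentMass.

Section CutDecay.
Variables (R : realType) (X : finType) (m M : nat) (ed : rel X) (o x : X).
Variables (f : X -> nat) (D : nat).
Hypothesis ed_irr : irreflexive ed.
Hypothesis ed_degree : degree_le ed D.
Hypothesis f_lip : lipschitz_nat ed f.
Hypothesis fo : f o = 0%N.
Hypothesis ox : o != x.
Variables (eta : point X M.+1 -> R) (eta0 : R).
Hypothesis eta_ge0 : forall p, 0 <= eta p.
Hypothesis eta0_ge0 : 0 <= eta0.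
Hypothesis eta_ge : forall p, p.1 != ord_max -> eta0 <= eta p.
Variables (wt : link X -> R) (delta kappa : R).
Hypothesis wt_ge0 : forall l, 0 <= wt l.
Hypothesis wt_None_gt0 : 0 < wt None.
Hypothesis wt_invalid : forall l, ~~ valid_link ed l -> wt l = 0.
Hypothesis edge_weight_le : forall e, edge_weight wt e <= delta.
Hypothesis kappa_gt0 : 0 < kappa.
Variable ell : R.
Implicit Types (w : {ffun 'I_M.+1 -> link X}).

Definition short_chain (c : seq (bond X M.+1)) : bool :=
  [&& path (follows ed) (root_bond M o) c, uniq (map fst c) & (travel 0 c)%:R <= 2 * ell].

Definition short_circuit w : bool :=
  [exists c : (f x).-tuple (bond X M.+1), short_chain c && all (occupied w) c].

Definition chain_ratio : R := (2 * m.+1)%:R * delta / wt None * bond_entropy kappa D.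

Definition long_component_factor : R := expR (- (eta0 * ((ell - 2) / 2))).

Lemma small_component_short_circuit w p : valid_links ed w ->
  cut_end o p ->
  let r := symrel (strel w [set o; x]) in
  connect r p (ord0, x) || connect r p (ord_max, x) ->
  #|connect r p|%:R <= ell -> short_circuit w.
Proof.
move=> w_valid p_o r p_x small.
have [q qx pq] : exists2 q : point X M.+1, q.2 = x & connect r p q.
  by case/orP: p_x; [exists (ord0, x)|exists (ord_max, x)].
have := connect_chain w_valid f_lip fo p_o pq; rewrite qx => -[c [path_c uniq_c occ_c cost_c]].
apply/existsP; exists c; rewrite /short_chain path_c uniq_c occ_c andbT /=.
by apply: le_trans (ler_wpM2l _ small); rewrite // -natrM ler_nat.
Qed.

Lemma large_component_mass_le w p :
  let r := strel w [set o; x] in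
  ell <= #|connect (symrel r) p|%:R ->
  expR (- component_mass r eta p) <= long_component_factor.
Proof.
move=> r large; rewrite ler_expR lerN2.
have wrap y : y \notin [set o; x] -> (ord_max, y) \in connect (symrel r) p ->
    (ord0, y) \in connect (symrel r) p.
  rewrite !unfold_in => y_cut py; apply: connect_trans py (connect_symrel _).
  by apply/strelP/StrelWrap.
apply: le_trans (wrapped_mass_ge eta_ge0 eta0_ge0 eta_ge wrap).
by rewrite ler_wpM2l // ler_pM2r ?invr_gt0 // cards2 ox lerB.
Qed.

Lemma cut_sum_le_short_circuit w : valid_links ed w ->
  cut_sum m w o x eta <=
  (2 * m.+1)%:R * ((long_component_factor + (short_circuit w)%:R) * spin_sum m eta w).
Proof.
move=> w_valid; apply: (cut_sum_le m ed_irr w_valid ox eta_ge0) => [|p p_o p_x].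
  by rewrite addr_ge0 ?expR_ge0.
have [small|/ltW large] := leP (#|connect (symrel (strel w [set o; x])) p|%:R) ell.
  rewrite (small_component_short_circuit w_valid p_o p_x small).
  apply: (@le_trans _ _ 1); last by rewrite lerDr expR_ge0.
  by rewrite expR_le1 oppr_le0 component_mass_ge0.
by apply: le_trans (large_component_mass_le large) _; rewrite lerDl.
Qed.

Lemma sum_short_chain_le :
  \sum_(c : (f x).-tuple (bond X M.+1) | short_chain c)
    ((2 * m.+1)%:R * delta / wt None) ^+ f x
  <= chain_ratio ^+ f x * expR (kappa * (2 * ell)).
Proof.
have delta_ge0 : 0 <= delta by apply: le_trans (edge_weight_le (o, o)); apply: addr_ge0.
have q_ge0 : 0 <= (2 * m.+1)%:R * delta / wt None by rewrite !mulr_ge0 ?invr_ge0 ?(ltW wt_None_gt0).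
rewrite /chain_ratio; set q := _ / _ in q_ge0 *; rewrite [in leRHS]exprMn [leRHS]mulrAC.
apply: le_trans (ler_wpM2l _ (sum_chains_le kappa_gt0 ed_degree (f x) (root_bond M o))); last first.
  by rewrite mulr_ge0 ?exprn_ge0 ?expR_ge0.
rewrite mulr_sumr big_mkcond [leRHS]big_mkcond; apply: ler_sum => c _.
case: ifP => [/and3P[-> _ short]|_]; last first.
  by case: ifP => // _; rewrite !mulr_ge0 ?exprn_ge0 ?expR_ge0.
rewrite -mulrA -expRD ler_peMr ?exprn_ge0 // -[leLHS]expR0 ler_expR.
by rewrite mulNr subr_ge0 ler_wpM2l ?(ltW kappa_gt0).
Qed.

Lemma sum_short_circuit_le :
  \sum_(w | short_circuit w) link_measure m eta wt w <=
  chain_ratio ^+ f x * expR (kappa * (2 * ell)) * \sum_w link_measure m eta wt w.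
Proof.
have mu_ge0 w : 0 <= link_measure m eta wt w by apply: link_measure_ge0.
apply: (@le_trans _ _ (\sum_(c : (f x).-tuple (bond X M.+1) | short_chain c)
   \sum_(w | all (occupied w) c) link_measure m eta wt w)).
  rewrite (exchange_big_dep xpredT) //= big_mkcond; apply: ler_sum => w _.
  case: ifP => [/existsP[c /andP[short_c occ_c]]|_]; last exact: sumr_ge0.
  by rewrite (bigD1 c) ?short_c ?occ_c //= lerDl sumr_ge0.
apply: le_trans (ler_wpM2r (sumr_ge0 _ _) sum_short_chain_le) => //.
rewrite mulr_suml; apply: ler_sum => c /and3P[_ uc _].
by have := sum_occupied_le m eta_ge0 wt_ge0 wt_None_gt0 edge_weight_le uc; rewrite size_tuple.
Qed.

Lemma sum_cut_sum_le :
  \sum_w link_prod wt w * cut_sum m w o x eta <=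
  (2 * m.+1)%:R * (long_component_factor + chain_ratio ^+ f x * expR (kappa * (2 * ell)))
    * \sum_w link_measure m eta wt w.
Proof.
apply: (@le_trans _ _ (\sum_w (2 * m.+1)%:R * (long_component_factor * link_measure m eta wt w +
   (short_circuit w)%:R * link_measure m eta wt w))).
  apply: ler_sum => w _; rewrite /link_measure.
  have -> : (2 * m.+1)%:R * (long_component_factor * (link_prod wt w * spin_sum m eta w) +
        (short_circuit w)%:R * (link_prod wt w * spin_sum m eta w)) =
      link_prod wt w * ((2 * m.+1)%:R *
        ((long_component_factor + (short_circuit w)%:R) * spin_sum m eta w)) by ring.
  have [/forallP w_valid|/forallPn[k w_k]] := boolP [forall k, valid_link ed (w k)].
    by rewrite ler_wpM2l ?link_prod_ge0 ?cut_sum_le_short_circuit.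
  by rewrite /link_prod (bigD1 k) //= wt_invalid // !mul0r.
rewrite -mulr_sumr -mulrA ler_wpM2l // big_split /= -mulr_sumr mulrDl lerD2l.
apply: le_trans sum_short_circuit_le.
rewrite [leRHS]big_mkcond; apply: ler_sum => w _.
by case: (short_circuit w); rewrite ?mul1r ?mul0r.
Qed.

End CutDecay.

(** * Traces as sums over links *)

Section PathSums.
Variables (R : comPzSemiRingType) (T : finType).
Implicit Types (P O : T -> T -> R) (s t : T).

Definition kernel_mx P : 'M[R]_#|T| := \matrix_(i, j) P (enum_val i) (enum_val j).

Lemma kernel_mxE P s t : kernel_mx P (enum_rank s) (enum_rank t) = P s t.
Proof. by rewrite mxE !enum_rankK. Qed.

Lemma sum_enum_rank (F : 'I_#|T| -> R) : \sum_i F i = \sum_(s : T) F (enum_rank s).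
Proof. by rewrite (reindex _ (onW_bij _ (@enum_rank_bij T))). Qed.

Lemma kernel_mxM P O : kernel_mx P *m kernel_mx O = kernel_mx (fun s t => \sum_r P s r * O r t).
Proof.
apply/matrixP => i j; rewrite !mxE sum_enum_rank; apply: eq_bigr => r _.
by rewrite !mxE enum_rankK.
Qed.

Definition ffcons n s (q : {ffun 'I_n -> T}) : {ffun 'I_n.+1 -> T} :=
  [ffun i => if unlift ord0 i is Some j then q j else s].

Lemma ffcons0 n s (q : {ffun 'I_n -> T}) : ffcons s q ord0 = s.
Proof. by rewrite ffunE unlift_none. Qed.

Lemma ffconsS n s (q : {ffun 'I_n -> T}) j : ffcons s q (lift ord0 j) = q j.
Proof. by rewrite ffunE liftK. Qed.

Lemma sum_ffcons n (F : {ffun 'I_n.+1 -> T} -> R) :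
  \sum_p F p = \sum_s \sum_(q : {ffun 'I_n -> T}) F (ffcons s q).
Proof.
rewrite pair_big (reindex (fun p : T * {ffun 'I_n -> T} => ffcons p.1 p.2)) //=.
exists (fun p : {ffun 'I_n.+1 -> T} => (p ord0, [ffun j => p (lift ord0 j)])) => [[s q]|p] _ /=.
  by rewrite ffcons0; congr (_, _); apply/ffunP => j; rewrite ffunE ffconsS.
by apply/ffunP => i; case: (unliftP ord0 i) => [j|] ->; rewrite ?ffcons0 // ffconsS ffunE.
Qed.

Lemma ffcons_max n s (q : {ffun 'I_n.+1 -> T}) : ffcons s q ord_max = q ord_max.
Proof. by rewrite -(ffconsS s q); congr (ffcons s q _); apply: val_inj. Qed.

Definition path_weight P M (p : {ffun 'I_M.+1 -> T}) : R :=
  \prod_k P (p (before k)) (p (after k)).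

Lemma path_weight_ffcons P M s (q : {ffun 'I_M.+1 -> T}) :
  path_weight P (ffcons s q) = P s (q ord0) * path_weight P q.
Proof.
rewrite /path_weight big_ord_recl; congr (P _ _ * _).
- by rewrite -[RHS](ffcons0 s q); congr (ffcons s q _); apply: val_inj.
- by rewrite -(ffconsS s q).
- apply: eq_bigr => k _; rewrite -!(ffconsS s q).
  by congr (P (ffcons s q _) _); apply: val_inj.
Qed.

Lemma kernel_mxX P M s t : (kernel_mx P ^+ M) (enum_rank s) (enum_rank t) =
  \sum_(q : {ffun 'I_M -> T} | ffcons s q ord_max == t) path_weight P (ffcons s q).
Proof.
elim: M s => [|M IHM] s.
  have ord_max0 : ord_max = ord0 :> 'I_1 by apply: val_inj.
  rewrite expr0 mxE (inj_eq enum_rank_inj).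
  under eq_bigl do rewrite ord_max0 ffcons0.
  under eq_bigr do rewrite /path_weight big_ord0.
  case: eqP => _; last by rewrite big_pred0.
  by rewrite sumr_const card_ffun card_ord expn0.
rewrite exprS mxE sum_enum_rank [RHS]big_mkcond sum_ffcons; apply: eq_bigr => r _.
rewrite kernel_mxE IHM mulr_sumr [LHS]big_mkcond; apply: eq_bigr => q _.
by rewrite ffcons_max path_weight_ffcons ffcons0.
Qed.

Lemma trace_kernel_mxX O P M : \tr (kernel_mx O *m kernel_mx P ^+ M) =
  \sum_(p : {ffun 'I_M.+1 -> T}) O (p ord_max) (p ord0) * path_weight P p.
Proof.
rewrite mxtrace_mulC sum_ffcons /mxtrace sum_enum_rank; apply: eq_bigr => s _.
rewrite mxE sum_enum_rank.
under eq_bigr => t _ do rewrite kernel_mxX kernel_mxE mulr_suml.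
rewrite [RHS](partition_big (fun q => ffcons s q ord_max) xpredT) //=.
apply: eq_bigr => t _; apply: eq_bigr => q /eqP <-.
by rewrite ffcons0 mulrC.
Qed.

End PathSums.

Section TransferMatrix.
Variables (R : realType) (X : finType) (m M : nat) (wt : link X -> R) (g : X -> R).
Local Notation conf := {ffun X -> 'I_m.+1}.
Implicit Types (s : {ffun point X M -> 'I_m.+1}) (c : conf).

Definition field_energy c : R := \sum_y g y * spin_val R (c y).

Definition transfer c c' : R :=
  expR (field_energy c) * \sum_(l : link X) wt l * (step l c c')%:R.

(* Level [M] is a copy of level [0], so it carries no weight of its own. *)
Definition level_field (p : point X M) : R := if p.1 == ord_max then 0 else g p.2.

Lemma before_neq_max (k : 'I_M) : (before k == ord_max) = false.
Proof. by apply/negbTE; rewrite -val_eqE /= neq_ltn ltn_ord. Qed.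

Lemma weight_level_field s :
  weight level_field s = \prod_k expR (field_energy (slice s (before k))).
Proof.
rewrite /weight -expR_sum; congr expR.
rewrite (eq_bigr (fun p => level_field (p.1, p.2) * spin_val R (s (p.1, p.2)))); last by case.
rewrite -(pair_big xpredT xpredT (fun i y => level_field (i, y) * spin_val R (s (i, y)))) /=.
rewrite big_ord_recr /= [X in _ + X]big1 ?addr0 => [|y _]; last first.
  by rewrite /level_field eqxx mul0r.
apply: eq_bigr => k _; apply: eq_bigr => y _.
by rewrite /slice ffunE /level_field before_neq_max.
Qed.

Lemma prod_links s :
  \prod_k \sum_(l : link X) wt l * (step l (slice s (before k)) (slice s (after k)))%:R =
  \sum_(w | trajectory w s) link_prod wt w.
Proof.
rewrite bigA_distr_bigA [RHS]big_mkcond; apply: eq_bigr => w _; rewrite big_split /= -natr_prod.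
case: ifP => [/forallP traj|/negbT/forallPn[k not_step]].
  by rewrite [X in _ * X%:R]big1 ?mulr1 // => k _; rewrite traj.
by rewrite [X in X%:R](bigD1 k) //= (negbTE not_step) mul0n mulr0.
Qed.

Lemma trace_transfer (O : conf -> conf -> R) :
  \tr (kernel_mx O *m kernel_mx transfer ^+ M) =
  \sum_w link_prod wt w *
    \sum_(s | trajectory w s) O (slice s ord_max) (slice s ord0) * weight level_field s.
Proof.
rewrite trace_kernel_mxX.
rewrite (reindex (fun s => [ffun i => slice s i])) /=; last first.
  exists (fun p : {ffun 'I_M.+1 -> conf} => [ffun q => p q.1 q.2]) => [s|p] _ /=.
    by apply/ffunP => -[i y]; rewrite !ffunE.
  by apply/ffunP => i; apply/ffunP => y; rewrite !ffunE.
under [RHS]eq_bigr => w _ do rewrite mulr_sumr.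
rewrite (exchange_big_dep xpredT) //=; apply: eq_bigr => s _.
under [RHS]eq_bigr => w _ do rewrite mulrC.
rewrite -mulr_sumr -prod_links weight_level_field !ffunE -mulrA -big_split.
by congr (_ * _); apply: eq_bigr => k _; rewrite !ffunE.
Qed.

End TransferMatrix.

(** * Spin models on graphs *)

Section GraphModel.
Variables (R : realType) (X : finType) (ed : rel X) (m : nat) (u : R) (h : X -> R).
Local Notation conf := {ffun X -> 'I_m.+1}.
Implicit Types (c : conf) (e : X * X) (delta : R).

Definition link_mx (l : link X) : 'M[R]_#|conf| := kernel_mx (fun c c' => (step l c c')%:R).

Definition coupling : 'M[R]_#|conf| :=
  \sum_(e | ed e.1 e.2)
    (u *: link_mx (Some (e, true)) + (1 - u) *: link_mx (Some (e, false)) - 1%:M).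

Definition field_row : 'rV[R]_#|conf| := \row_i field_energy h (enum_val i).

(* Minus the Hamiltonian. *)
Definition generator : 'M[R]_#|conf| := coupling + diag_mx field_row.

Definition num_edges : nat := #|[pred e | ed e.1 e.2]|.

Definition link_weight delta (l : link X) : R :=
  match l with
  | None => 1 - delta * num_edges%:R
  | Some (e, v) => if ed e.1 e.2 then delta * (if v then u else 1 - u) else 0
  end.

Definition transfer_mx delta : 'M[R]_#|conf| :=
  kernel_mx (transfer (link_weight delta) (fun y => delta * h y)).

Lemma sum_option (V : nmodType) (T : finType) (F : option T -> V) :
  \sum_l F l = F None + \sum_t F (Some t).
Proof.
rewrite (bigD1 None) //=; congr (_ + _).
by rewrite (reindex_omap Some id) => [|[]] //=; apply: eq_bigl => t; rewrite eqxx.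
Qed.

Lemma transfer_mxE delta :
  transfer_mx delta = diag_mx (map_mx expR (delta *: field_row)) *m (1 + delta *: coupling).
Proof.
apply/matrixP => i j; rewrite mul_diag_mx !mxE; congr (expR _ * _).
  by rewrite /field_energy mulr_sumr; apply: eq_bigr => y _; rewrite mulrA.
rewrite sum_option /= (inj_eq enum_val_inj) mulrBl mul1r -addrA; congr (_ + _).
rewrite summxE (eq_bigr (fun p => link_weight delta (Some (p.1, p.2)) *
  (step (Some (p.1, p.2)) (enum_val i) (enum_val j))%:R)) => [|[]//].
rewrite -(pair_big xpredT xpredT (fun e v => link_weight delta (Some (e, v)) *
  (step (Some (e, v)) (enum_val i) (enum_val j))%:R)) /=.
have -> : num_edges%:R = \sum_(e | ed e.1 e.2) 1 :> R by rewrite sumr_const.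
rewrite mulr_sumr mulr_suml -sumrN big_mkcond -big_split mulr_sumr [RHS]big_mkcond.
apply: eq_bigr => e _ /=; rewrite big_bool /=; case: ifP => _; last by rewrite !mul0r !addr0.
rewrite !mxE; ring.
Qed.

Lemma cvg_transfer_mx beta i j :
  ((transfer_mx (beta / N.+1%:R) ^+ N.+1) i j @[N --> \oo]
     --> mxexp (beta *: generator) i j)%classic.
Proof.
have := @cvg_trotter_diag R _ (beta *: coupling) (beta *: field_row) i j.
have -> : beta *: coupling + diag_mx (beta *: field_row) = beta *: generator.
  by rewrite linearZ -scalerDr.
by under eq_fun do rewrite !scalerA ![_^-1 * beta]mulrC -transfer_mxE.
Qed.

Lemma cvg_trace_transfer_mx (O : 'M[R]_#|conf|) beta :
  (\tr (O *m transfer_mx (beta / N.+1%:R) ^+ N.+1) @[N --> \oo]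
     --> \tr (O *m mxexp (beta *: generator)))%classic.
Proof.
apply: cvg_big => [|i _]; first exact: add_continuous.
under eq_fun do rewrite mxE; rewrite mxE.
apply: cvg_big => [|j _]; first exact: add_continuous.
by apply: cvgMr; apply: cvg_transfer_mx.
Qed.

Section SmallSteps.
Variables (delta : R) (M : nat).
Hypothesis u01 : 0 <= u <= 1.
Hypothesis delta_ge0 : 0 <= delta.
Hypothesis delta_small : delta * num_edges%:R <= 2^-1.
Local Notation wt := (link_weight delta).
Local Notation eta := (level_field (M := M) (fun y => delta * h y)).

Lemma link_weight_None_ge : 2^-1 <= wt None.
Proof. by rewrite /=; move: delta_small; lra. Qed.

Lemma link_weight_None_gt0 : 0 < wt None.
Proof. by apply: lt_le_trans link_weight_None_ge; rewrite invr_gt0. Qed.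

Lemma link_weight_ge0 l : 0 <= wt l.
Proof.
case: l => [[e v]|]; last by rewrite ltW ?link_weight_None_gt0.
rewrite /=; case: ifP => // _; case/andP: u01 => u0 u1.
by rewrite mulr_ge0 //; case: v; rewrite ?subr_ge0.
Qed.

Lemma edge_weight_link_weight_le e : edge_weight wt e <= delta.
Proof.
rewrite /edge_weight /=; case: ifP => _; last by rewrite addr0.
by rewrite -mulrDr addrC subrK mulr1.
Qed.

Lemma link_weight_invalid l : ~~ valid_link ed l -> wt l = 0.
Proof. by case: l => [[[a b] v]|] //= /negbTE->. Qed.

Lemma trace_transfer_mx : \tr (transfer_mx delta ^+ M) = \sum_w link_measure m eta wt w.
Proof.
have -> : transfer_mx delta ^+ M = kernel_mx (fun c c' => (c == c')%:R) *m transfer_mx delta ^+ M.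
  rewrite -[LHS]mul1mx; congr (_ *m _); apply/matrixP => i j.
  by rewrite !mxE (inj_eq enum_val_inj).
rewrite trace_transfer; apply: eq_bigr => w _; congr (_ * _).
rewrite /spin_sum [LHS]big_mkcond [RHS]big_mkcond; apply: eq_bigr => s _.
have [/compatible_strelP[-> wrap]|] := boolP (compatible _ _).
  have -> : slice s ord_max = slice s ord0 by apply/ffunP => y; rewrite !ffunE wrap ?inE.
  by rewrite eqxx mul1r.
case: ifP => // traj; case: eqP => [/ffunP wrap|_]; last by rewrite mul0r.
case/negP; apply/compatible_strelP; split=> // y _.
by have := wrap y; rewrite !ffunE.
Qed.

Lemma trace_transfer_mx_ge0 : 0 <= \tr (transfer_mx delta ^+ M).
Proof.
rewrite trace_transfer_mx; apply: sumr_ge0 => w _.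
exact: (link_measure_ge0 _ _ link_weight_ge0).
Qed.

End SmallSteps.

End GraphModel.

Section LocalOperators.
Variables (R : numDomainType) (X : finType) (m : nat) (A : 'I_m.+1 -> 'I_m.+1 -> R).
Hypothesis A_ge0 : forall a b, 0 <= A a b.
Hypothesis A_diag : forall a, A a a = 0.
Local Notation conf := {ffun X -> 'I_m.+1}.
Implicit Types (c : conf) (x y z : X).

Definition local_kernel z c c' : R := A (c z) (c' z) * (agree_outside (pred1 z) c c')%:R.

Definition two_point o x c c' : R := \sum_c1 local_kernel o c c1 * local_kernel x c1 c'.

Definition local_bound : R := \sum_a \sum_b A a b.

Definition cut_pair o x c c' : bool :=
  agree_outside (mem [set o; x]) c c' && ((o != x) ==> (c o != c' o) && (c x != c' x)).

Lemma local_bound_ge0 : 0 <= local_bound.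
Proof. by do 2!apply: sumr_ge0 => ? _. Qed.

Lemma local_bound_ge a b : A a b <= local_bound.
Proof.
rewrite /local_bound (bigD1 a) //= (bigD1 b) //= -addrA lerDl addr_ge0 ?sumr_ge0 // => i _.
exact: sumr_ge0.
Qed.

Lemma local_kernel_ge0 z c c' : 0 <= local_kernel z c c'.
Proof. by rewrite mulr_ge0. Qed.

Lemma local_kernel_le z c c' :
  local_kernel z c c' <= local_bound * (agree_outside (pred1 z) c c' && (c z != c' z))%:R.
Proof.
rewrite /local_kernel; case: agree_outside; rewrite ?mulr0 //= mulr1.
by case: eqP => [->|_]; rewrite ?A_diag ?mulr0 // mulr1 local_bound_ge.
Qed.

Definition two_point_path o x c c' c1 : bool :=
  [&& agree_outside (pred1 o) c c1, c o != c1 o, agree_outside (pred1 x) c1 c' & c1 x != c' x].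

Lemma two_point_path_cut_pair o x c c' c1 : two_point_path o x c c' c1 -> cut_pair o x c c'.
Proof.
case/and4P => /agree_outsideP off_o co /agree_outsideP off_x cx; apply/andP; split.
  by apply/agree_outsideP => y; rewrite !inE negb_or => /andP[yo yx]; rewrite off_o ?off_x.
by apply/implyP => ox; rewrite -(off_x o ox) co (off_o x) //= eq_sym.
Qed.

Lemma card_two_point_path o x c c' : (#|two_point_path o x c c'| <= m.+1)%N.
Proof.
rewrite -[leqRHS]card_ord; apply: (@leq_card_in _ _ (fun c1 : conf => c1 o)) => c1 c2.
move=> /and4P[/agree_outsideP off1 _ _ _] /and4P[/agree_outsideP off2 _ _ _] c12; apply/ffunP => y.
by have [->//|yo] := eqVneq y o; rewrite -off1 ?off2.
Qed.

Lemma two_point_le o x c c' : two_point o x c c' <=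
  local_bound ^+ 2 * m.+1%:R * (cut_pair o x c c')%:R.
Proof.
apply: (@le_trans _ _ (\sum_c1 local_bound ^+ 2 * (two_point_path o x c c' c1)%:R)).
  apply: ler_sum => c1 _.
  apply: le_trans (ler_pM (local_kernel_ge0 _ _ _) (local_kernel_ge0 _ _ _)
     (local_kernel_le _ _ _) (local_kernel_le _ _ _)) _.
  by rewrite mulrACA -expr2 -natrM mulnb -!andbA.
rewrite -mulr_sumr -mulrA ler_wpM2l ?exprn_ge0 ?local_bound_ge0 //.
rewrite -natr_sum -big_mkcond sum1_card.
have [_|nc] := boolP (cut_pair _ _ _ _); first by rewrite mulr1 ler_nat card_two_point_path.
rewrite mulr0 lern0; apply/eqP/eq_card0 => c1; apply/negbTE.
exact: contraNN (@two_point_path_cut_pair _ _ _ _ c1) nc.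
Qed.

End LocalOperators.

Section TwoPointDecay.
Variables (R : realType) (X : finType) (ed : rel X) (m : nat) (u : R) (h : X -> R).
Variables (A : 'I_m.+1 -> 'I_m.+1 -> R) (o x : X) (delta : R).
Hypothesis A_ge0 : forall a b, 0 <= A a b.
Hypothesis A_diag : forall a, A a a = 0.
Hypothesis u01 : 0 <= u <= 1.
Hypothesis h_ge0 : forall y, 0 <= h y.
Hypothesis delta_ge0 : 0 <= delta.
Hypothesis delta_small : delta * (num_edges ed)%:R <= 2^-1.
Local Notation wt := (link_weight ed u delta).
Local Notation T := (transfer_mx ed m u h delta).
Local Notation P := (kernel_mx (two_point A o x)).

Lemma level_field_ge0 M (p : point X M) : 0 <= level_field (fun y => delta * h y) p.
Proof. by rewrite /level_field; case: ifP => // _; rewrite mulr_ge0. Qed.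

Lemma trace_two_point_le M :
  \tr (P *m T ^+ M) <= local_bound A ^+ 2 * m.+1%:R * \sum_w link_prod wt w *
    \sum_(s : {ffun point X M -> 'I_m.+1} | compatible (strel w [set o; x]) s &&
      ((o != x) ==> jumps s o && jumps s x)) weight (level_field (fun y => delta * h y)) s.
Proof.
have C0 : 0 <= local_bound A ^+ 2 * m.+1%:R by rewrite mulr_ge0 ?exprn_ge0 ?local_bound_ge0.
rewrite trace_transfer mulr_sumr; apply: ler_sum => w _; rewrite mulrCA.
apply: ler_wpM2l; first exact: (link_prod_ge0 (link_weight_ge0 u01 delta_ge0 delta_small)).
rewrite mulr_sumr [leLHS]big_mkcond [leRHS]big_mkcond; apply: ler_sum => s _.
set good := compatible _ _ && _; case: ifP => [traj|_]; last first.
  by case: ifP => // _; rewrite mulr_ge0 ?expR_ge0.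
apply: le_trans (ler_wpM2r (expR_ge0 _) (two_point_le A_ge0 A_diag _ _ _ _)) _.
suff good_of_cut : cut_pair o x (slice s ord_max) (slice s ord0) -> good.
  case: (boolP (cut_pair _ _ _ _)) => [/good_of_cut->|_]; first by rewrite mulr1.
  by rewrite mulr0 mul0r; case: ifP => // _; rewrite mulr_ge0 ?expR_ge0.
case/andP => /agree_outsideP off jump; apply/andP; split.
  by apply/compatible_strelP; split=> // y /off; rewrite !ffunE.
by move: jump; rewrite /jumps !ffunE ![s (ord0, _) == _]eq_sym.
Qed.

Lemma trace_two_point_diag_le M : o = x ->
  \tr (P *m T ^+ M) <= local_bound A ^+ 2 * m.+1%:R * (2 * m.+1)%:R * \tr (T ^+ M).
Proof.
move=> ox; apply: le_trans (trace_two_point_le M) _; rewrite -[leRHS]mulrA.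
apply: ler_wpM2l; first by rewrite mulr_ge0 ?exprn_ge0 ?local_bound_ge0.
rewrite trace_transfer_mx mulr_sumr; apply: ler_sum => w _; rewrite mulrCA.
apply: ler_wpM2l; first exact: (link_prod_ge0 (link_weight_ge0 u01 delta_ge0 delta_small)).
set eta := level_field _; rewrite -ox eqxx.
under eq_bigl do rewrite andbT.
have merge_le := @sum_compatible_merge R m _ (strel w [set o; o]) eta (@level_field_ge0 M)
  (ord0, o) (ord_max, o).
apply: le_trans merge_le _.
rewrite ler_wpM2l // /spin_sum [leLHS]big_mkcond [leRHS]big_mkcond; apply: ler_sum => s _.
case: ifP => [/andP[cs /eqP so]|_]; last by case: ifP => // _; apply: expR_ge0.
rewrite ifT //; apply: compatible_strel_glue cs _ => y.
by rewrite !inE orbb => /eqP->.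
Qed.

End TwoPointDecay.

Section DecayRate.
Variables (R : realType) (m D : nat) (alpha : R).
Hypothesis D_gt0 : (0 < D)%N.
Hypothesis alpha_gt0 : 0 < alpha.

(* With this tilt a chain of bonds has weight at most [expR (- 2)] per bond. *)
Definition tilt : R := 16 * (2 * m.+1)%:R * D%:R * expR 2.

Definition decay_rate : R := Num.min (alpha / (4 * tilt)) 1.

Lemma tilt_gt0 : 0 < tilt.
Proof. by rewrite !mulr_gt0 ?expR_gt0 ?ltr0n. Qed.

Lemma decay_rate_gt0 : 0 < decay_rate.
Proof. by rewrite lt_min ltr01 andbT divr_gt0 // mulr_gt0 // tilt_gt0. Qed.

Lemma half_le_one_sub_expRN (t : R) : 0 <= t <= 1 -> t / 2 <= 1 - expR (- t).
Proof.
move=> /andP[t0 t1]; have e1 := expR_ge1Dx t; have e0 := expR_gt0 (- t).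
have : expR (- t) * (1 + t) <= 1.
  by rewrite expRN -ler_pdivlMl ?invr_gt0 ?expR_gt0 // invrK mulr1.
nra.
Qed.

Lemma chain_ratio_le (X : finType) (wt : link X -> R) delta :
  0 < delta -> tilt * delta <= 1 -> 2^-1 <= wt None ->
  0 <= chain_ratio m D wt delta (tilt * delta) <= expR (- 2).
Proof.
move=> delta0 tilt_delta wt2; have tilt0 := tilt_gt0.
have wt0 : 0 < wt None by apply: lt_le_trans wt2; rewrite invr_gt0.
have kappa0 : 0 < tilt * delta by rewrite mulr_gt0.
have half := half_le_one_sub_expRN (introT andP (conj (ltW kappa0) tilt_delta)).
have q0 : 0 <= (2 * m.+1)%:R * delta / wt None by rewrite !mulr_ge0 ?invr_ge0 ?ltW.
rewrite mulr_ge0 ?bond_entropy_ge0 //=.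
have -> : expR (- 2) = (2 * m.+1)%:R * delta * 2 * (D%:R * (4 / (tilt * delta / 2))) :> R.
  rewrite expRN /tilt; have := expR_gt0 (2 : R); have D0 : 0 < D%:R :> R by rewrite ltr0n.
  by move=> e0; field; rewrite !gt_eqF.
apply: ler_pM => //; first exact: bond_entropy_ge0.
  by rewrite ler_wpM2l ?mulr_ge0 ?(ltW delta0) // -[leRHS]invrK lef_pV2 ?posrE ?invr_gt0.
rewrite ler_wpM2l // ler_wpM2l // lef_pV2 ?posrE ?divr_gt0 //.
by apply: lt_le_trans half; rewrite divr_gt0.
Qed.

Variables (delta : R) (n : nat).
Hypothesis delta_gt0 : 0 < delta.

(* Chosen so that undoing the tilt along a short chain costs at most [expR n]. *)
Definition long_threshold : R := n%:R / (2 * (tilt * delta)).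

Lemma long_component_factor_le : alpha * delta <= 1 ->
  long_component_factor (delta * alpha) long_threshold <= expR 1 * expR (- decay_rate * n%:R).
Proof.
move=> alpha_delta; have tilt0 := tilt_gt0.
rewrite /long_component_factor -expRD ler_expR.
have -> : - (delta * alpha * ((long_threshold - 2) / 2)) =
    alpha * delta - alpha / (4 * tilt) * n%:R.
  by rewrite /long_threshold; field; rewrite !gt_eqF.
by rewrite lerD // mulNr lerN2 ler_wpM2r // ge_min lexx.
Qed.

Lemma short_chain_factor_le (X : finType) (wt : link X -> R) :
  tilt * delta <= 1 -> 2^-1 <= wt None ->
  chain_ratio m D wt delta (tilt * delta) ^+ n * expR (tilt * delta * (2 * long_threshold))
    <= expR (- decay_rate * n%:R).
Proof.
move=> tilt_delta wt2; have tilt0 := tilt_gt0.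
have /andP[ratio0 ratio_le] := chain_ratio_le delta_gt0 tilt_delta wt2.
have -> : tilt * delta * (2 * long_threshold) = n%:R.
  by rewrite /long_threshold; field; rewrite !gt_eqF.
apply: (@le_trans _ _ (expR (- 2) ^+ n * expR n%:R)).
  by rewrite ler_wpM2r ?expR_ge0 ?lerXn2r ?nnegrE ?expR_ge0.
rewrite -expRM_natl -expRD ler_expR.
have -> : n%:R * - 2 + n%:R = - 1 * n%:R :> R by ring.
by rewrite ler_wpM2r // lerN2 ge_min lexx orbT.
Qed.

End DecayRate.

Section GraphDecay.
Variables (R : realType) (X : finType) (ed : rel X) (m : nat) (o : X) (f : X -> nat) (D : nat).
Variables (A : 'I_m.+1 -> 'I_m.+1 -> R) (alpha : R).
Hypothesis ed_irr : irreflexive ed.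
Hypothesis ed_degree : degree_le ed D.
Hypothesis D_gt0 : (0 < D)%N.
Hypothesis f_lip : lipschitz_nat ed f.
Hypothesis fo : f o = 0%N.
Hypothesis A_ge0 : forall a b, 0 <= A a b.
Hypothesis A_diag : forall a, A a a = 0.
Hypothesis alpha_gt0 : 0 < alpha.
Local Notation tilt := (tilt R m D).
Local Notation rate := (decay_rate m D alpha).

Definition decay_const : R := local_bound A ^+ 2 * m.+1%:R * (2 * m.+1)%:R * (expR 1 + 1).

Lemma decay_const_ge0 : 0 <= decay_const.
Proof. by rewrite !mulr_ge0 ?exprn_ge0 ?local_bound_ge0 ?addr_ge0 ?expR_ge0. Qed.

Section FixedModel.
Variables (u : R) (h : X -> R) (x : X).
Hypothesis u01 : 0 <= u <= 1.
Hypothesis h_ge : forall y, alpha <= h y.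
Local Notation T := (transfer_mx ed m u h).
Local Notation P := (kernel_mx (two_point A o x)).

Lemma trace_cut_sum_le delta M : o != x ->
  0 < delta -> delta * (num_edges ed)%:R <= 2^-1 -> alpha * delta <= 1 -> tilt * delta <= 1 ->
  \sum_w link_prod (link_weight ed u delta) w *
     cut_sum m w o x (level_field (M := M.+1) (fun y => delta * h y)) <=
  (2 * m.+1)%:R * (expR 1 + 1) * expR (- rate * (f x)%:R) * \tr (T delta ^+ M.+1).
Proof.
move=> ox delta0 edges_delta alpha_delta tilt_delta; have tilt0 := tilt_gt0 R m D_gt0.
have delta_ge0 := ltW delta0; have kappa0 : 0 < tilt * delta by rewrite mulr_gt0.
have h0 y : 0 <= h y := le_trans (ltW alpha_gt0) (h_ge y).
have wt0 := link_weight_ge0 u01 delta_ge0 edges_delta.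
have eta_ge (p : point X M.+1) :
    p.1 != ord_max -> delta * alpha <= level_field (fun y => delta * h y) p.
  by rewrite /level_field => /negbTE->; rewrite ler_wpM2l.
have eta0_ge0 : 0 <= delta * alpha by rewrite mulr_ge0 // ltW.
have := sum_cut_sum_le m ed_irr ed_degree f_lip fo ox
  (@level_field_ge0 _ _ _ _ h0 delta_ge0 M.+1) eta0_ge0 eta_ge wt0
  (link_weight_None_gt0 u edges_delta) (@link_weight_invalid _ _ ed u delta)
  (edge_weight_link_weight_le ed u delta_ge0) kappa0 (long_threshold m D delta (f x)).
move/le_trans; apply; rewrite trace_transfer_mx ler_wpM2r //.
  by apply: sumr_ge0 => w _; apply: link_measure_ge0.
rewrite -[leRHS]mulrA ler_wpM2l // [leRHS]mulrDl mul1r lerD //.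
  exact: long_component_factor_le.
by apply: short_chain_factor_le => //; apply: link_weight_None_ge.
Qed.

Lemma trace_transfer_decay delta M :
  0 < delta -> delta * (num_edges ed)%:R <= 2^-1 -> alpha * delta <= 1 -> tilt * delta <= 1 ->
  \tr (P *m T delta ^+ M.+1) <=
    decay_const * expR (- rate * (f x)%:R) * \tr (T delta ^+ M.+1).
Proof.
move=> delta0 edges_delta alpha_delta tilt_delta; have delta_ge0 := ltW delta0.
have h0 y : 0 <= h y := le_trans (ltW alpha_gt0) (h_ge y).
have B0 : 0 <= local_bound A ^+ 2 * m.+1%:R by rewrite mulr_ge0 ?exprn_ge0 ?local_bound_ge0.
have T0 := trace_transfer_mx_ge0 m h M.+1 u01 delta_ge0 edges_delta.
have [ox|ox] := eqVneq o x.
  apply: le_trans (trace_two_point_diag_le A_ge0 A_diag u01 h0 delta_ge0 edges_delta M.+1 ox) _.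
  rewrite ler_wpM2r // -ox fo mulr0 expR0 mulr1 ler_peMr ?(mulr_ge0 B0) //.
  by rewrite lerDr expR_ge0.
apply: le_trans (trace_two_point_le h o x A_ge0 A_diag u01 delta_ge0 edges_delta M.+1) _.
have cut_le := trace_cut_sum_le M ox delta0 edges_delta alpha_delta tilt_delta.
apply: le_trans (le_trans (ler_wpM2l B0 cut_le) _); first by rewrite ox.
by rewrite /decay_const !mulrA.
Qed.

Lemma trace_mxexp_decay beta : 0 < beta ->
  \tr (P *m mxexp (beta *: generator ed m u h)) <=
    decay_const * expR (- rate * (f x)%:R) * \tr (mxexp (beta *: generator ed m u h)).
Proof.
move=> beta0; set C := decay_const * _.
have cvgP := @cvg_trace_transfer_mx R X ed m u h P beta.
have cvg1 : (C * \tr (T (beta / N.+1%:R) ^+ N.+1) @[N --> \oo]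
    --> C * \tr (mxexp (beta *: generator ed m u h)))%classic.
  have := @cvg_trace_transfer_mx R X ed m u h 1%:M beta; rewrite mul1mx.
  by under eq_fun do rewrite mul1mx; apply: cvgMr.
apply: (ler_cvg_to cvgP cvg1).
have half_gt0 : 0 < 2^-1 :> R by rewrite invr_gt0.
have edges_small := near_mul_divS_le (num_edges ed)%:R beta half_gt0.
have alpha_small := near_mul_divS_le alpha beta ltr01.
have tilt_small := near_mul_divS_le tilt beta ltr01.
near=> N; apply: trace_transfer_decay; first by rewrite divr_gt0.
- by rewrite mulrC; near: N.
- by near: N.
- by near: N.
Unshelve. all: by end_near.
Qed.

End FixedModel.

End GraphDecay.

(** * Positivity *)

Section Positivity.
Variables (R : realType) (X : finType) (ed : rel X) (m : nat) (u : R) (h : X -> R).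
Hypothesis u01 : 0 <= u <= 1.
Local Notation conf := {ffun X -> 'I_m.+1}.
Local Notation G := (generator ed m u h).
Implicit Types (c : conf) (S : {set X}) (a b y z : X).

Definition link_rate (v : bool) : R := if v then u else 1 - u.

Lemma link_rate_ge0 v : 0 <= link_rate v.
Proof. by case/andP: u01 => u0 u1; case: v; rewrite ?subr_ge0. Qed.

Lemma generator_offdiag i j : i != j ->
  G i j = \sum_(e | ed e.1 e.2) \sum_v link_rate v * link_mx R m (Some (e, v)) i j.
Proof.
move=> /negbTE ij; rewrite !mxE ij mulr0n addr0 summxE; apply: eq_bigr => e _.
by rewrite big_bool !mxE ij subr0.
Qed.

Lemma generator_metzler : metzler G.
Proof.
move=> i j ij; rewrite generator_offdiag //.
by do 2!apply: sumr_ge0 => ? _; rewrite mulr_ge0 ?link_rate_ge0 // mxE.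
Qed.

Definition reachable c c' : bool :=
  connect (fun i j => 0 < G i j) (enum_rank c) (enum_rank c').

Lemma reachable_step e v c c' : ed e.1 e.2 -> 0 < link_rate v ->
  step (Some (e, v)) c c' -> reachable c c'.
Proof.
move=> ed_e v_gt0 st; have [->|cc'] := eqVneq c c'; first exact: connect0.
apply: connect1; rewrite generator_offdiag ?(inj_eq enum_rank_inj) //.
have terms_ge0 e' v' : 0 <= link_rate v' * link_mx R m (Some (e', v')) (enum_rank c) (enum_rank c').
  by rewrite mulr_ge0 ?link_rate_ge0 // mxE.
rewrite (bigD1 e) //= ltr_pwDl //; last by do 2!apply: sumr_ge0 => ? _.
rewrite (bigD1 v) //= ltr_pwDl //; last by apply: sumr_ge0.
by rewrite [link_mx _ _ _ _ _]kernel_mxE st mulr1.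
Qed.

Lemma reachable_symrel a b v c c' : symrel ed a b -> 0 < link_rate v ->
  (forall e, e = (a, b) \/ e = (b, a) -> step (Some (e, v)) c c') -> reachable c c'.
Proof.
by move=> /orP[] ed_ab v_gt0 st; [apply: (@reachable_step (a, b) v) => //|
  apply: (@reachable_step (b, a) v) => //]; apply: st; [left|right].
Qed.

Lemma reachable_T a b c c' : 0 < u -> symrel ed a b -> c a = c' b -> c b = c' a ->
  agree_outside (pred2 a b) c c' -> reachable c c'.
Proof.
move=> u0 ed_ab cab cba /agree_outsideP off; apply: (@reachable_symrel _ _ true _ _ ed_ab) => // e.
by case=> -> /=; rewrite cab cba !eqxx; apply/agree_outsideP => y yab; apply: off;
  rewrite //= orbC.
Qed.

Lemma reachable_Q a b c c' : u < 1 -> symrel ed a b -> c a = c b -> c' a = c' b ->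
  agree_outside (pred2 a b) c c' -> reachable c c'.
Proof.
move=> u1 ed_ab cab c'ab /agree_outsideP off.
apply: (@reachable_symrel _ _ false _ _ ed_ab) => [|e]; first by rewrite subr_gt0.
by case=> -> /=; rewrite cab c'ab !eqxx; apply/agree_outsideP => y yab; apply: off;
  rewrite //= orbC.
Qed.

Lemma reachable_trans c2 c1 c3 : reachable c1 c2 -> reachable c2 c3 -> reachable c1 c3.
Proof. exact: connect_trans. Qed.

Definition excited S : conf := [ffun z => if z \in S then inord 1 else ord0].

Lemma reachable_T_path o p : 0 < u -> path (symrel ed) o p ->
  reachable (excited [set o]) (excited [set last o p]).
Proof.
move=> u0; elim: p o => [|y p IHp] o /=; first by move=> _; apply: connect0.
case/andP=> oy /IHp; apply: reachable_trans; apply: (reachable_T u0 oy).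
- by rewrite !ffunE !inE !eqxx.
- by rewrite !ffunE !inE eq_sym.
- by apply/agree_outsideP => z; rewrite negb_or !ffunE !inE => /andP[/negbTE-> /negbTE->].
Qed.

Lemma reachable_pair S a b : u < 1 -> symrel ed a b -> a \notin S -> b \notin S ->
  reachable (excited S) (excited (a |: (b |: S))) /\
  reachable (excited (a |: (b |: S))) (excited S).
Proof.
move=> u1 ed_ab aS bS; split; apply: (reachable_Q u1 ed_ab);
  try by rewrite !ffunE ?inE ?eqxx ?orbT ?(negbTE aS) ?(negbTE bS).
all: by apply/agree_outsideP => z; rewrite negb_or !ffunE !inE => /andP[/negbTE-> /negbTE->].
Qed.

(* Along [o], [y], [z]: create a pair at [y] and [z], then annihilate the one at [o] and [y]. *)
Lemma reachable_double_hop S o y z : u < 1 -> symrel ed o y -> symrel ed y z ->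
  uniq [:: o; y; z] -> o \notin S -> y \notin S -> z \notin S ->
  reachable (excited (o |: S)) (excited (z |: S)).
Proof.
rewrite /= !inE negb_or andbT => u1 oy yz /andP[/andP[neq_oy neq_oz] neq_yz] oS yS zS.
have create := (reachable_pair (S := o |: S) u1 yz _ _).1.
have annihilate := (reachable_pair (S := z |: S) u1 oy _ _).2.
apply: reachable_trans (create _ _) _; rewrite ?inE ?negb_or 1?eq_sym ?neq_oy ?neq_oz //.
have -> : y |: (z |: (o |: S)) = o |: (y |: (z |: S)).
  by rewrite (finset.setUCA [set z]) finset.setUCA.
by apply: annihilate; rewrite !inE negb_or ?neq_oz ?neq_yz.
Qed.

Lemma reachable_Q_path S o p : u < 1 -> path (symrel ed) o p -> uniq (o :: p) ->
  ~~ odd (size p) -> {in o :: p, forall z, z \notin S} ->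
  reachable (excited (o |: S)) (excited (last o p |: S)).
Proof.
move=> u1; have [n] := ubnP (size p); elim: n o p => // n IHn o [|y [|z p]] //=.
  by move=> *; apply: connect0.
rewrite !ltnS negbK => size_p /and3P[oy yz zp] uniq_p even_p avoid.
have avoids v : v \in [:: o, y, z & p] -> v \notin S by apply: avoid.
apply: (@reachable_trans (excited (z |: S))).
  apply: (reachable_double_hop u1 oy yz); rewrite ?avoids ?inE ?eqxx ?orbT //.
  by move: uniq_p; rewrite /= !inE !negb_or -!andbA => /and5P[-> -> _ -> _].
apply: IHn => //; first exact: ltnW.
  by move: uniq_p; rewrite /= => /and3P[_ _].
by move=> v vp; apply: avoids; rewrite inE in_cons vp !orbT.
Qed.

Lemma reachable_Q_odd_path o p : u < 1 -> path (symrel ed) o p -> uniq (o :: p) ->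
  odd (size p) -> reachable (excited [set o; last o p]) (excited finset.set0).
Proof.
move=> u1; case/lastP: p => // p y; rewrite rcons_path last_rcons size_rcons /=.
move=> /andP[op py]; rewrite -[_ && _]/(uniq (rcons (o :: p) y)) rcons_uniq.
move=> /andP[yp uniq_p] even_p.
have avoid z : z \in o :: p -> z \notin [set y] by rewrite inE; apply: contraTneq => ->.
apply: reachable_trans (reachable_Q_path u1 op uniq_p even_p avoid) _.
rewrite -[[set y]]finset.setU0.
by apply: (reachable_pair (S := finset.set0) u1 py _ _).2; rewrite inE.
Qed.

Variables (beta : R) (A : 'I_m.+1 -> 'I_m.+1 -> R) (o x : X).
Hypothesis beta_gt0 : 0 < beta.
Hypothesis A_ge0 : forall i j, 0 <= A i j.
Hypothesis A_raise : 0 < A ord0 (inord 1).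
Hypothesis A_lower : 0 < A (inord 1) ord0.
Local Notation E := (mxexp (beta *: G)).

Lemma scaled_generator_metzler : metzler (beta *: G).
Proof. by move=> i j ij; rewrite mxE mulr_ge0 ?(ltW beta_gt0) ?generator_metzler. Qed.

Lemma mxexp_generator_nneg : E \is a mxOver Num.nneg.
Proof. exact: mxexp_ge0 scaled_generator_metzler. Qed.

Lemma mxexp_generator_gt0 c c' : reachable c c' -> 0 < E (enum_rank c) (enum_rank c').
Proof.
move=> cc'; apply: mxexp_gt0 scaled_generator_metzler _.
by apply: connect_sub cc' => i j ij; apply: connect1; rewrite mxE mulr_gt0.
Qed.

Lemma trace_mxexp_generator_gt0 : 0 < \tr E.
Proof.
apply: (mxtrace_gt0 (i := enum_rank (excited finset.set0)) mxexp_generator_nneg).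
exact/mxexp_generator_gt0/connect0.
Qed.

Lemma trace_two_point_mxexp_gt0 c c' : 0 < two_point A o x c c' -> reachable c' c ->
  0 < \tr (kernel_mx (two_point A o x) *m E).
Proof.
move=> P_gt0 c'c; have P_nneg : kernel_mx (two_point A o x) \is a mxOver Num.nneg.
  apply/mxOverP => i j; rewrite nnegrE mxE; apply: sumr_ge0 => c1 _.
  by rewrite mulr_ge0 ?local_kernel_ge0.
apply: (mxtrace_gt0 (i := enum_rank c)); first by rewrite mxOverM ?mxexp_generator_nneg.
apply: (mulmx_gt0 (k := enum_rank c') P_nneg mxexp_generator_nneg).
  by rewrite kernel_mxE.
exact: mxexp_generator_gt0.
Qed.

Lemma local_kernel_excited_gt0 z S S' : (z \in S) != (z \in S') ->
  (forall y, y != z -> (y \in S) = (y \in S')) ->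
  0 < local_kernel A z (excited S) (excited S').
Proof.
move=> z_flip off; rewrite mulr_gt0 //.
  by rewrite !ffunE; case: (z \in S) z_flip; case: (z \in S').
by rewrite ltr0n lt0b; apply/agree_outsideP => y yz; rewrite !ffunE off.
Qed.

Lemma two_point_excited_gt0 S S1 S2 :
  (o \in S) != (o \in S1) -> (forall y, y != o -> (y \in S) = (y \in S1)) ->
  (x \in S1) != (x \in S2) -> (forall y, y != x -> (y \in S1) = (y \in S2)) ->
  0 < two_point A o x (excited S) (excited S2).
Proof.
move=> o_flip off_o x_flip off_x; rewrite /two_point (bigD1 (excited S1)) //=.
apply: ltr_pwDl; first by apply: mulr_gt0; apply: local_kernel_excited_gt0.
by apply: sumr_ge0 => c _; rewrite mulr_ge0 ?local_kernel_ge0.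
Qed.

Lemma trace_two_point_transport_gt0 : o != x ->
  reachable (excited [set o]) (excited [set x]) ->
  0 < \tr (kernel_mx (two_point A o x) *m E).
Proof.
move=> ox; apply: trace_two_point_mxexp_gt0; apply: (@two_point_excited_gt0 _ [set o; x]).
- by rewrite !inE (negbTE ox) eqxx.
- by move=> y /negbTE yo; rewrite !inE yo.
- by rewrite !inE eqxx orbT [x == o]eq_sym (negbTE ox).
- by move=> y /negbTE yx; rewrite !inE yx orbF.
Qed.

Lemma trace_two_point_annihilation_gt0 : o != x ->
  reachable (excited [set o; x]) (excited finset.set0) ->
  0 < \tr (kernel_mx (two_point A o x) *m E).
Proof.
move=> ox; apply: trace_two_point_mxexp_gt0; apply: (@two_point_excited_gt0 _ [set o]).
- by rewrite !inE eqxx.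
- by move=> y /negbTE yo; rewrite !inE yo.
- by rewrite !inE eqxx orbT [x == o]eq_sym (negbTE ox).
- by move=> y /negbTE yx; rewrite !inE yx orbF.
Qed.

Lemma trace_two_point_gt0 : connect (symrel ed) o x ->
  0 < \tr (kernel_mx (two_point A o x) *m E).
Proof.
have [ox _|ox] := eqVneq o x.
  apply: (@trace_two_point_mxexp_gt0 (excited finset.set0) (excited finset.set0)).
    by apply: (@two_point_excited_gt0 _ [set o]); rewrite -?ox ?inE ?eqxx // => y /negbTE yo;
      rewrite !inE yo.
  exact: connect0.
case/connectP => p0 op0 xE; have [u0|u0] := ltP 0 u.
  by apply: trace_two_point_transport_gt0; rewrite // xE; apply: reachable_T_path.
have u1 : u < 1 by apply: le_lt_trans u0 ltr01.
case/shortenP: op0 xE => p op uniq_p _ xE; have [odd_p|even_p] := boolP (odd (size p)).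
  by apply: trace_two_point_annihilation_gt0; rewrite // xE; apply: reachable_Q_odd_path.
apply: trace_two_point_transport_gt0 => //.
rewrite -[[set o]]finset.setU0 -[[set x]]finset.setU0 xE.
by apply: reachable_Q_path => // z _; rewrite inE.
Qed.

End Positivity.

(** * The lattice *)

Lemma sum_sqr_le_sqr_sum (R : realDomainType) (I : Type) (r : seq I) (F : I -> R) :
  (forall i, 0 <= F i) -> \sum_(i <- r) F i ^+ 2 <= (\sum_(i <- r) F i) ^+ 2.
Proof.
move=> F0; elim: r => [|i r IHr]; first by rewrite !big_nil expr0n.
rewrite !big_cons sqrrD -addrA lerD2l; apply: le_trans IHr _.
by rewrite lerDr mulrn_wge0 // mulr_ge0 // sumr_ge0.
Qed.

Section Lattice.
Variables (d l : nat).
Local Notation o := (origin d l).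
Implicit Types (x y : site d l).

(* Each unordered nearest-neighbour pair is oriented once. *)
Definition edge x y : bool := nn x y && (enum_rank x < enum_rank y)%N.
Definition l1norm x : nat := (\sum_(i < d) absz (Defs.coord x i))%N.

Lemma edge_irr : irreflexive edge.
Proof. by move=> x; rewrite /edge ltnn andbF. Qed.

Lemma nnC x y : nn x y = nn y x.
Proof. by rewrite /nn; congr (_ == _); apply: eq_bigr => i _; rewrite -abszN opprB. Qed.

Lemma nnxx x : nn x x = false.
Proof. by rewrite /nn big1 // => i _; rewrite subrr. Qed.

Lemma symrel_edge x y : symrel edge x y = nn x y.
Proof.
rewrite /symrel /edge (nnC y) -andb_orr -neq_ltn.
have [<-|xy] := eqVneq x y; first by rewrite nnxx.
by rewrite (inj_eq val_inj) (inj_eq enum_rank_inj) xy andbT.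
Qed.

Lemma nn_coord x y i : nn x y -> (absz (Defs.coord x i - Defs.coord y i) <= 1)%N.
Proof. by move=> /eqP<-; rewrite (bigD1 i) //= leq_addr. Qed.

Lemma coord_origin i : Defs.coord o i = 0.
Proof. by rewrite /Defs.coord ffunE inordK ?subrr //; lia. Qed.

Lemma l1norm_origin : l1norm o = 0%N.
Proof. by rewrite /l1norm big1 // => i _; rewrite coord_origin. Qed.

Lemma l1norm_eq0 x : l1norm x = 0%N -> x = o.
Proof.
move=> /eqP; rewrite sum_nat_eq0 => /forallP coord0; apply/ffunP => i; apply: val_inj.
by have := coord0 i; rewrite /= ffunE inordK /Defs.coord; lia.
Qed.

Lemma l1norm_lipschitz : lipschitz_nat edge l1norm.
Proof.
move=> x y; rewrite symrel_edge => /eqP nn_xy; rewrite -addn1 -nn_xy /l1norm -big_split.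
by apply: leq_sum => i _ /=; lia.
Qed.

Lemma l1norm_descent x n : l1norm x = n.+1 -> exists2 y, nn y x & l1norm y = n.
Proof.
move=> norm_x; have [i xi] : exists i, Defs.coord x i != 0.
  apply/existsP; apply: contraPT norm_x => /existsPn coord0; rewrite /l1norm big1 // => i _.
  by have := coord0 i; rewrite negbK => /eqP->.
pose v : nat := if (x i <= l)%N then (x i).+1 else (x i).-1.
have v_step : (absz (v%:Z - (x i)%:Z)%R = 1 /\ (absz (v%:Z - l%:Z)%R).+1 = absz (Defs.coord x i))%N.
  by move: xi; rewrite /v /Defs.coord; case: (leqP (x i) l) => ? ?; split; lia.
have v_lt : (v < (2 * l).+1)%N.
  by have := ltn_ord (x i); rewrite /v; move: xi; rewrite /Defs.coord; case: (leqP (x i) l); lia.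
pose y : site d l := [ffun j => if j == i then Ordinal v_lt else x j].
have yi : Defs.coord y i = v%:Z - l%:Z by rewrite /Defs.coord ffunE eqxx.
have yj j : j != i -> Defs.coord y j = Defs.coord x j.
  by rewrite /Defs.coord ffunE => /negbTE->.
exists y.
  rewrite /nn (bigD1 i) //= big1 => [|j ji]; last by rewrite yj // subrr.
  by rewrite yi /Defs.coord; lia.
apply: succn_inj; rewrite -norm_x /l1norm (bigD1 i) //= [RHS](bigD1 i) //= yi -v_step.2.
by rewrite -addSn; congr (_ + _)%N; apply: eq_bigr => j ji; rewrite yj.
Qed.

Lemma connect_origin x : connect (symrel edge) o x.
Proof.
have [n] := ubnP (l1norm x); elim: n x => // n IHn x; rewrite ltnS => norm_x.
case norm_eq : (l1norm x) norm_x => [|k] k_lt; first by rewrite (l1norm_eq0 norm_eq).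
have [y yx norm_y] := l1norm_descent norm_eq.
by apply: connect_trans (IHn y _) (connect1 _); rewrite ?norm_y ?symrel_edge.
Qed.

Definition direction x y : {ffun 'I_d -> 'I_3} := [ffun i => inord (y i + 1 - x i)].

Lemma directionE x y i : nn x y -> (direction x y i + x i = y i + 1)%N.
Proof. by move=> /(nn_coord i); rewrite ffunE /Defs.coord => xy; rewrite inordK; lia. Qed.

Lemma incident_inj (e : site d l * site d l) :
  {in incident e &, injective (fun z => z == e.1)}.
Proof.
move=> z z'; rewrite !unfold_in /incident.
by case: (z =P e.1) => [->|_]; case: (z' =P e.1) => [->|_] //= /eqP-> /eqP->.
Qed.

(* An edge meeting [e] is determined by the endpoint at which it meets [e],
   which of its own endpoints that is, and its direction. *)
Lemma edge_degree_le : degree_le edge (4 * 3 ^ d).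
Proof.
move=> e; have -> : (4 * 3 ^ d = #|{: bool * bool * {ffun 'I_d -> 'I_3}}|)%N.
  by rewrite !card_prod card_bool card_ffun !card_ord.
pose code (e' : site d l * site d l) := (incident e e'.1,
   if incident e e'.1 then e'.1 == e.1 else e'.2 == e.1, direction e'.1 e'.2).
apply: (@leq_card_in _ _ code) => -[a b] [a' b'].
move=> /andP[/andP[/= ab _] meet] /andP[/andP[/= ab' _] meet'].
case=> inc_eq end_eq dir_eq.
have shift i : (b i + a' i = b' i + a i)%N.
  have := directionE i ab; have := directionE i ab'; rewrite dir_eq.
  by move: (nat_of_ord (a i)) (nat_of_ord (b i)) (nat_of_ord (a' i)) (nat_of_ord (b' i)) => *; lia.
move: meet meet' end_eq; rewrite /meets /= -inc_eq.
case: ifP => inc_a /= meet meet' end_eq.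
  have inc_a' : incident e a' by rewrite -inc_eq.
  have aa' : a = a' := incident_inj inc_a inc_a' end_eq.
  by congr (_, _) => //; apply/ffunP => i; apply: val_inj; have := shift i; rewrite aa' /=; lia.
have bb' : b = b' := incident_inj meet meet' end_eq.
by congr (_, _) => //; apply/ffunP => i; apply: val_inj; have := shift i; rewrite bb' /=; lia.
Qed.

Lemma eucl_norm_le_l1norm (R : realType) x : eucl_norm R x <= (l1norm x)%:R.
Proof.
rewrite /eucl_norm -[leRHS]ger0_norm // -sqrtr_sqr ler_sqrt ?sqr_ge0 // natr_sum.
apply: le_trans (sum_sqr_le_sqr_sum _ _) => //; apply: ler_sum => i _.
by rewrite -[leLHS]ger0_norm ?sqr_ge0 // normrX natr_absz intr_norm.
Qed.

End Lattice.

(** * The spin system on the lattice *)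

Section SpinOne.
Variables (R : realType) (m : nat).

Lemma S1_loc_ge0 (a b : 'I_m.+1) : 0 <= S1_loc R a b.
Proof. by rewrite /S1_loc; case: ifP => // _; rewrite divr_ge0 ?sqrtr_ge0. Qed.

Lemma S1_loc_diag (a : 'I_m.+1) : S1_loc R a a = 0.
Proof. by rewrite /S1_loc ifF // orbb; lia. Qed.

Lemma S1_loc_lowest_gt0 : (0 < m)%N ->
  0 < S1_loc R (ord0 : 'I_m.+1) (inord 1) /\ 0 < S1_loc R (inord 1) (ord0 : 'I_m.+1).
Proof.
move=> m0; have m0R : 0 < m%:R :> R by rewrite ltr0n.
rewrite /S1_loc /spin_val /spinS inordK //=; split; rewrite divr_gt0 // sqrtr_gt0; lra.
Qed.

End SpinOne.

Section LatticeModel.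
Variables (R : realType) (d l m : nat) (u : R) (h : site d l -> R).
Local Notation o := (origin d l).
Local Notation G := (generator (@edge d l) m u h).
Local Notation P x := (kernel_mx (two_point (@S1_loc R m) o x)).

Lemma field_sum_diag_mx : \sum_x h x *: S3_op R m x = diag_mx (field_row m h).
Proof.
apply/matrixP => i j; rewrite summxE !mxE -sumrMnl; apply: eq_bigr => x _.
rewrite !mxE /S3_loc; have [<-|ij] := eqVneq i j.
  by rewrite eqxx (_ : agree_off _ _ _) ?mul1r ?mulr1 //; apply/forallP => z; rewrite eqxx orbT.
case: eqP => [ij_x|_]; last by rewrite !mul0r mulr0.
suff /negbTE-> : ~~ agree_off (enum_val i) (enum_val j) (pred1 x) by rewrite !mulr0.
apply: contra ij => /forallP agree; rewrite -(inj_eq enum_val_inj); apply/eqP/ffunP => z.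
by have /orP[/eqP->|/eqP] := agree z.
Qed.

Lemma hamiltonianE : hamiltonian m u h = - G.
Proof.
rewrite /hamiltonian /generator opprD field_sum_diag_mx; congr (- _ - _).
by rewrite pair_big_dep; apply: eq_bigr => -[x y].
Qed.

Lemma gibbs_two_pointE beta x :
  gibbs beta u h (S1_op R m o *m S1_op R m x) =
  \tr (P x *m mxexp (beta *: G)) / \tr (mxexp (beta *: G)).
Proof. by rewrite /gibbs hamiltonianE scalerN scaleNr opprK -kernel_mxM. Qed.

End LatticeModel.

Theorem theorem1p1 (R : realType) (d m : nat) (alpha : R) :
  (0 < d)%N -> (0 < m)%N -> 0 < alpha ->
  exists C c : R, 0 < C /\ 0 < c /\
    forall (u beta : R) (l : nat) (h : site d l -> R),
      0 <= u <= 1 -> 0 < beta -> (forall x, alpha <= h x) ->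
      forall x : site d l,
        0 < @gibbs R d l m beta u h (S1_op R m (origin d l) *m S1_op R m x) /\
        @gibbs R d l m beta u h (S1_op R m (origin d l) *m S1_op R m x)
          < C * expR (- c * eucl_norm R x).
Proof.
move=> _ m0 alpha0; have D0 : (0 < 4 * 3 ^ d)%N by rewrite muln_gt0 expn_gt0.
pose C := decay_const (@S1_loc R m); pose c := decay_rate m (4 * 3 ^ d) alpha.
have C0 : 0 <= C by apply/decay_const_ge0/S1_loc_ge0.
have c0 : 0 < c by apply: decay_rate_gt0.
exists (C + 1), c; split; first by rewrite ltr_wpDl.
split=> // u beta l h u01 beta0 h_ge x; rewrite gibbs_two_pointE.
have [S1_raise S1_lower] := S1_loc_lowest_gt0 R m0.
have Z0 := trace_mxexp_generator_gt0 (@edge d l) m h u01 beta0.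
split.
  rewrite divr_gt0 //; apply: trace_two_point_gt0 => //; first exact: S1_loc_ge0.
  exact: connect_origin.
have decay := trace_mxexp_decay (@edge_irr d l) (@edge_degree_le d l) D0 (@l1norm_lipschitz d l)
  (l1norm_origin d l) (@S1_loc_ge0 R m) (@S1_loc_diag R m) alpha0 x u01 h_ge beta0.
rewrite ltr_pdivrMr //; apply: le_lt_trans decay _; rewrite ltr_pM2r //.
apply: (@le_lt_trans _ _ (C * expR (- c * eucl_norm R x))); last first.
  by rewrite ltr_pM2r ?expR_gt0 // ltrDl.
by rewrite ler_wpM2l // ler_expR !mulNr lerN2 ler_wpM2l ?(ltW c0) // eucl_norm_le_l1norm.
Qed.
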